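(* Let $\{\rho_\tau\}_{\tau=1}^{\overline\tau}\subset\mathbb R_{>0}$ and let $(p^{(\tau)},q^{(\tau)},u^{(\tau)},\overline p^{(\tau)},\overline q^{(\tau)},\overline u^{(\tau)})$, $\tau=1,\dots,\overline\tau$, be iterates generated by the basic penalty alternating direction method (described in the context) with penalty schedule $\{\rho_\tau\}$, where the subproblems $Z^{\mathrm T}_t$ are solved to stationarity. Let $C:=\sum_{t\in\mathcal T} d\,L_tD_t$. Then $$\Gamma_1\big(p^{(\tau)},q^{(\tau)},u^{(\tau)},\overline p^{(\tau-1)},\overline q^{(\tau-1)},\overline u^{(\tau-1)}\big)\le\sqrt{\frac{C}{2\rho_\tau}}\qquad\text{for all }\tau\in\{2,\dots,\overline\tau\}.$$ If moreover the subproblems $Z^{\mathrm J}_j$ are solved to global optimality, then $$\Gamma_1\big(\overline p^{(\tau)},\overline q^{(\tau)},\overline u^{(\tau)},\overline p^{(\tau-1)},\overline q^{(\tau-1)},\overline u^{(\tau-1)}\big)\le\frac{R}{\rho_\tau}+\sqrt{\frac{2C}{\rho_\tau}}\qquad\text{for all }\tau\in\{2,\dots,\overline\tau\},$$ $$\Gamma_1\big(p^{(\tau+1)},q^{(\tau+1)},u^{(\tau+1)},p^{(\tau)},q^{(\tau)},u^{(\tau)}\big)\le\frac{R}{\rho_\tau}+\sqrt{\frac{2C}{\min\{\rho_\tau,\rho_{\tau+1}\}}}\qquad\text{for all }\tau\in\{2,\dots,\overline\tau-1\}.$$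
   Context: **Index sets.** $\mathcal T=\{1,\dots,T\}$ are time periods with lengths $d_t>0$ (the symbol $d$ without index, below, is a different quantity). $\mathcal J^{\mathrm{pr}},\mathcal J^{\mathrm{cs}}$ are disjoint finite sets of producing and consuming devices, $\mathcal J^{\mathrm{sd}}=\mathcal J^{\mathrm{pr}}\cup\mathcal J^{\mathrm{cs}}$; $\mathcal I$ is the finite set of buses; $\mathcal J^{\mathrm{ac}},\mathcal J^{\mathrm{dc}}$ are the finite sets of AC and DC branches, $\mathcal J^{\mathrm{br}}$ their disjoint union, branch $j$ going from bus $i_j$ to bus $i'_j$; $\mathcal J^{\mathrm{sh}}$ is the finite set of shunts; each device or shunt $j$ sits at bus $i_j$; $\mathcal R$ is a finite set of real reserve products. $[x]^+=\max\{x,0\}$. A subscript $j$ or $t$ on $p,q,u$ denotes the sub-collection of variables with that index. **Device constraints** ($j\in\mathcal J^{\mathrm{sd}}$, $t\in\mathcal T$; $u^{\mathrm{on}}_{j0}\in\{0,1\}$ and $p^{\mathrm{tot}}_{j0}$ are data). Data: $p^{\mathrm{supc}}_{jtt'},p^{\mathrm{sdpc}}_{jtt'}\ge0$, $\mathcal T^{\mathrm{supc}}_{jt}=\{t'\in\mathcal T:t'>t,\ p^{\mathrm{supc}}_{jtt'}>0\}$, $\mathcal T^{\mathrm{sdpc}}_{jt}=\{t'\in\mathcal T:t'\le t,\ p^{\mathrm{sdpc}}_{jtt'}>0\}$; polyhedra $\mathcal X^{\mathrm u}_j$ (linear commitment rules) and $\mathcal X^{\mathrm p}_{jt}$ (linear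 power/reserve bounds); reals $q^{\max}_{jt},q^{\min}_{jt},\beta^{\max}_j,\beta^{\min}_j$ and ramp rates $p^{\mathrm{ru}}_j,p^{\mathrm{rd}}_j,p^{\mathrm{ru,su}}_j,p^{\mathrm{rd,sd}}_j$. (U) $u^{\mathrm{on}}_{jt}-u^{\mathrm{on}}_{j,t-1}=u^{\mathrm{su}}_{jt}-u^{\mathrm{sd}}_{jt}$; $u^{\mathrm{su}}_{jt}+u^{\mathrm{sd}}_{jt}\le1$; $\{u^{\mathrm{on}}_{jt},u^{\mathrm{su}}_{jt},u^{\mathrm{sd}}_{jt}\}_{t\in\mathcal T}\in\mathcal X^{\mathrm u}_j$; $u^{\mathrm{on}}_{jt},u^{\mathrm{su}}_{jt},u^{\mathrm{sd}}_{jt}\in\{0,1\}$. (P1) $p^{\mathrm{tot}}_{jt}=p^{\mathrm{on}}_{jt}+p^{\mathrm{su}}_{jt}+p^{\mathrm{sd}}_{jt}$. (P2) $p^{\mathrm{su}}_{jt}=\sum_{t'\in\mathcal T^{\mathrm{supc}}_{jt}}p^{\mathrm{supc}}_{jtt'}u^{\mathrm{su}}_{jt'}$, $p^{\mathrm{sd}}_{jt}=\sum_{t'\in\mathcal T^{\mathrm{sdpc}}_{jt}}p^{\mathrm{sdpc}}_{jtt'}u^{\mathrm{sd}}_{jt'}$. (P3) $(u^{\mathrm{on}}_{jt},p^{\mathrm{tot}}_{jt},p^{\mathrm{on}}_{jt},\{p^{\mathrm{res}}_{jtr}\}_{r\in\mathcal R})\in\mathcal X^{\mathrm p}_{jt}$.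 (P4) $p^{\mathrm{tot}}_{jt},p^{\mathrm{on}}_{jt},p^{\mathrm{res}}_{jtr}\ge0$. (Q) With $\sigma_{jt}:=u^{\mathrm{on}}_{jt}+\sum_{t'\in\mathcal T^{\mathrm{supc}}_{jt}}u^{\mathrm{su}}_{jt'}+\sum_{t'\in\mathcal T^{\mathrm{sdpc}}_{jt}}u^{\mathrm{sd}}_{jt'}$: $q^{\mathrm{tot}}_{jt}\le q^{\max}_{jt}\sigma_{jt}+\beta^{\max}_jp^{\mathrm{tot}}_{jt}-q^{\mathrm{res}}_{jta}$ and $q^{\mathrm{tot}}_{jt}\ge q^{\min}_{jt}\sigma_{jt}+\beta^{\min}_jp^{\mathrm{tot}}_{jt}+q^{\mathrm{res}}_{jtb}$, where $(a,b)=(\uparrow,\downarrow)$ if $j\in\mathcal J^{\mathrm{pr}}$ and $(a,b)=(\downarrow,\uparrow)$ if $j\in\mathcal J^{\mathrm{cs}}$; $q^{\mathrm{res}}_{jt\uparrow},q^{\mathrm{res}}_{jt\downarrow}\ge0$. (R) $-d_t\big(p^{\mathrm{rd}}_ju^{\mathrm{on}}_{jt}+p^{\mathrm{rd,sd}}_j(1-u^{\mathrm{on}}_{jt})\big)\le p^{\mathrm{tot}}_{jt}-p^{\mathrm{tot}}_{j,t-1}\le d_t\big(p^{\mathrm{ru}}_j(u^{\mathrm{on}}_{jt}-u^{\mathrm{su}}_{jt})+p^{\mathrm{ru,su}}_j(u^{\mathrm{su}}_{jt}-u^{\mathrm{on}}_{jt}+1)\big)$. **Network constraints** ($t\in\mathcal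 T$; $g,b$ with indices are real data). (F1) For $j\in\mathcal J^{\mathrm{ac}}$: $\Delta_{jt}=\theta_{i_jt}-\theta_{i'_jt}-\phi_{jt}$; $p^{\mathrm{fr}}_{jt}=v_{i_jt}\big(g_{i_jj}v_{i_jt}/\tau_{jt}^2+\frac{v_{i'_jt}}{\tau_{jt}}(-g_j\cos\Delta_{jt}-b_j\sin\Delta_{jt})\big)$; $p^{\mathrm{to}}_{jt}=v_{i'_jt}\big(g_{i'_jj}v_{i'_jt}+\frac{v_{i_jt}}{\tau_{jt}}(-g_j\cos\Delta_{jt}+b_j\sin\Delta_{jt})\big)$; $q^{\mathrm{fr}}_{jt}=v_{i_jt}\big(-b_{i_jj}v_{i_jt}/\tau_{jt}^2+\frac{v_{i'_jt}}{\tau_{jt}}(b_j\cos\Delta_{jt}-g_j\sin\Delta_{jt})\big)$; $q^{\mathrm{to}}_{jt}=v_{i'_jt}\big(-b_{i'_jj}v_{i'_jt}+\frac{v_{i_jt}}{\tau_{jt}}(b_j\cos\Delta_{jt}+g_j\sin\Delta_{jt})\big)$. (F2) $p^{\mathrm{fr}}_{jt}+p^{\mathrm{to}}_{jt}=0$ for $j\in\mathcal J^{\mathrm{dc}}$; $p^{\mathrm{sh}}_{jt}=g^{\mathrm{sh}}_ju^{\mathrm{sh}}_{jt}v_{i_jt}^2$ and $q^{\mathrm{sh}}_{jt}=-b^{\mathrm{sh}}_ju^{\mathrm{sh}}_{jt}v_{i_jt}^2$ for $j\in\mathcal J^{\mathrm{sh}}$. (F3) $v_{it}\in[v^{\min}_i,v^{\max}_i]$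 for $i\in\mathcal I$; $\phi_{jt}\in[\phi^{\min}_j,\phi^{\max}_j]$, $\tau_{jt}\in[\tau^{\min}_j,\tau^{\max}_j]$ for $j\in\mathcal J^{\mathrm{ac}}$; $p^{\mathrm{fr}}_{jt},p^{\mathrm{to}}_{jt}\in[-p^{\max}_j,p^{\max}_j]$, $q^{\mathrm{fr}}_{jt}\in[q^{\mathrm{fr,min}}_j,q^{\mathrm{fr,max}}_j]$, $q^{\mathrm{to}}_{jt}\in[q^{\mathrm{to,min}}_j,q^{\mathrm{to,max}}_j]$ for $j\in\mathcal J^{\mathrm{dc}}$; the voltage and tap bounds are positive. (F4) $u^{\mathrm{sh}}_{jt}\in[u^{\mathrm{sh,min}}_j,u^{\mathrm{sh,max}}_j]\cap\mathbb Z_+$ for $j\in\mathcal J^{\mathrm{sh}}$, with integral bounds. **Objective terms.** $C^{\mathrm{uc}}_j(u)=\sum_{t}\big(c^{\mathrm{on}}_{jt}u^{\mathrm{on}}_{jt}+c^{\mathrm{su}}_ju^{\mathrm{su}}_{jt}+c^{\mathrm{sd}}_ju^{\mathrm{sd}}_{jt}-\sum_{t'<t}c^{\mathrm{dd}}_{jtt'}[u^{\mathrm{su}}_{jt}+u^{\mathrm{on}}_{jt'}-1]^+\big)$ with $c^{\mathrm{su}}_j,c^{\mathrm{sd}}_j,c^{\mathrm{dd}}_{jtt'}\ge0$. $C^{\mathrm e}_j(p)=c^{\mathrm e}\big(\sum_{W\in\mathcal W^{\mathrm{en,min}}_j}[e^{\min}_j(W)-\sum_{t\in W}d_tp^{\mathrm{tot}}_{jt}]^++\sum_{W\in\mathcal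 W^{\mathrm{en,max}}_j}[-e^{\max}_j(W)+\sum_{t\in W}d_tp^{\mathrm{tot}}_{jt}]^+\big)$, $c^{\mathrm e}\ge0$, where $\mathcal W^{\mathrm{en,min}}_j,\mathcal W^{\mathrm{en,max}}_j$ are finite families of subsets of $\mathcal T$. $C^{\mathrm{pow}}_{jt}$ ($j\in\mathcal J^{\mathrm{pr}}$) is a convex and $R^{\mathrm{pow}}_{jt}$ ($j\in\mathcal J^{\mathrm{cs}}$) a concave piecewise linear function of $p^{\mathrm{tot}}_{jt}$. $C^{\mathrm{res}}_t(p,q)=d_t\Big(\sum_{j,r}c^{\mathrm{res,p}}_{jtr}p^{\mathrm{res}}_{jtr}+\sum_{R'\subset\mathcal R}c^{\mathrm{res}}_{R'}\sum_{N\in\mathcal N^{\mathrm p}}\big[p^{\mathrm{res,min}}_t(p;R',N)-\sum_{r\in R'}\sum_{j\in N}p^{\mathrm{res}}_{jtr}\big]^++\sum_{r\in\{\uparrow,\downarrow\}}\big(\sum_jc^{\mathrm{res,q}}_{jtr}q^{\mathrm{res}}_{jtr}+c^{\mathrm{res}}_r\sum_{N\in\mathcal N^{\mathrm q}}[q^{\mathrm{res,min}}_t(q;r,N)-\sum_{j\in N}q^{\mathrm{res}}_{jtr}]^+\big)\Big)$, where $\mathcal N^{\mathrm p},\mathcal N^{\mathrm q}$ are finite families of subsets of $\mathcal J^{\mathrm{sd}}$, the coefficients $c^{\mathrm{res}}$ are nonnegative, and each requirement function is a constant, or a nonnegative multiple of the sum or of the maximum over $j\in N$ of the period-$t$ injections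 (so $C^{\mathrm{res}}_t$ is convex). $C^{\mathrm{ac}}_{jt}(p,q)=c^{\mathrm s}d_t\big[\max\{\|(p^{\mathrm{fr}}_{jt},q^{\mathrm{fr}}_{jt})\|_2,\|(p^{\mathrm{to}}_{jt},q^{\mathrm{to}}_{jt})\|_2\}-s^{\max}_j\big]^+$, $c^{\mathrm s}\ge0$. $C^{\mathrm{bal}}_{it}(p,q)=d_t(c^{\mathrm p}|B_{it}(p)|+c^{\mathrm q}|B_{it}(q)|)$, $c^{\mathrm p},c^{\mathrm q}\ge0$, where for $x\in\{p,q\}$, $B_{it}(x)=\sum_{j\in\mathcal J^{\mathrm{pr}},i_j=i}x^{\mathrm{tot}}_{jt}-\sum_{j\in\mathcal J^{\mathrm{cs}},i_j=i}x^{\mathrm{tot}}_{jt}-\sum_{j\in\mathcal J^{\mathrm{sh}},i_j=i}x^{\mathrm{sh}}_{jt}-\sum_{j\in\mathcal J^{\mathrm{br}},i_j=i}x^{\mathrm{fr}}_{jt}-\sum_{j\in\mathcal J^{\mathrm{br}},i'_j=i}x^{\mathrm{to}}_{jt}$. $C^{\mathrm{ctg}}_t=\frac1K\sum_{k=1}^KC^{\mathrm{ctg}}_{kt}+\max_kC^{\mathrm{ctg}}_{kt}$, $C^{\mathrm{ctg}}_{kt}(p,q)=c^{\mathrm s}d_t\sum_{j\in\mathcal J^{\mathrm{ac}},j\ne j_k}\big[\|(f_{kjt}(p),\max\{|q^{\mathrm{fr}}_{jt}|,|q^{\mathrm{to}}_{jt}|\})\|_2-s^{\mathrm{max,ctg}}_j\big]^+$,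 $f_{kjt}(p)=\sum_{i\in\mathcal I}F_{kji}\big(p^{\mathrm{inj}}_{it}(p)-\frac1{|\mathcal I|}\sum_{i'\in\mathcal I}p^{\mathrm{inj}}_{i't}(p)\big)$ with real data $F_{kji}$, $j_k\in\mathcal J^{\mathrm{ac}}$, and $p^{\mathrm{inj}}_{it}(p)$ equal to $B_{it}(p)$ with the sums over $\mathcal J^{\mathrm{br}}$ restricted to $\mathcal J^{\mathrm{dc}}$. $R^{\mathrm T}_t=-C^{\mathrm{res}}_t-C^{\mathrm{ctg}}_t-\sum_{j\in\mathcal J^{\mathrm{ac}}}C^{\mathrm{ac}}_{jt}-\sum_{i\in\mathcal I}C^{\mathrm{bal}}_{it}$ (a concave function of $(p_t,q_t)$). $R^{\mathrm J}_j=-C^{\mathrm{uc}}_j-C^{\mathrm e}_j+\sum_tR^{\mathrm{pow}}_{jt}$ if $j\in\mathcal J^{\mathrm{cs}}$, and $R^{\mathrm J}_j=-C^{\mathrm{uc}}_j-C^{\mathrm e}_j-\sum_tC^{\mathrm{pow}}_{jt}$ if $j\in\mathcal J^{\mathrm{pr}}$. **Standing assumption.** (1) $c^{\mathrm{su}}_j\ge\sum_{t'<t}c^{\mathrm{dd}}_{jtt'}$ for all $j,t$. (2) For each $j\in\mathcal J^{\mathrm{sd}}$, every $u_j$ satisfying (U) satisfies (S): $u^{\mathrm{on}}_{jt}+\sum_{t'\in\mathcal T^{\mathrm{supc}}_{jt}}u^{\mathrm{su}}_{jt'}\le1$ and $u^{\mathrm{on}}_{jt}+\sum_{t'\in\mathcal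 T^{\mathrm{sdpc}}_{jt}}u^{\mathrm{sd}}_{jt'}\le1$ for all $t$. (3) The sets $\mathcal X^{\mathrm p}_{jt}$ are closed, convex, bounded and polyhedral. (4) The problem of maximizing $\sum_tR^{\mathrm T}_t(p,q)+\sum_{j\in\mathcal J^{\mathrm{sd}}}R^{\mathrm J}_j(p,u)$ subject to (U), (P1)–(P4), (Q), (R), (F1)–(F4) is feasible with nonnegative optimal value. **Sets.** $\mathcal X^{\mathrm{uc}}_j=\{(p_j,q_j,u_j):\text{(U),(P1)–(P4),(Q),(R) for device }j\}$; $\mathcal X^{\mathrm{ac}}_t=\{(p_t,q_t,u^{\mathrm{sh}}_t):\exists(v_t,\Delta_t,\theta_t,\tau_t,\phi_t)\text{ with (F1)–(F3) at }t\}$; $\mathcal X^{\mathrm{sh}}_{jt}=\{u^{\mathrm{sh}}_{jt}:\text{(F4)}\}$; $\mathcal Y^{\mathrm{sh}}_{jt}=[u^{\mathrm{sh,min}}_j,u^{\mathrm{sh,max}}_j]$; $\mathcal Y^{\mathrm{uc}}_{jt}$ is the set of $(p_{jt},q_{jt},u^{\mathrm{on}}_{jt})$ with $u^{\mathrm{on}}_{jt}\ge0$ for which there exist $(u^{\mathrm{su}}_j,u^{\mathrm{sd}}_j)\in[0,1]^{2T}$ satisfying at $(j,t)$ the constraints (P1), (P3), (P4), (Q), (S) and $0\le p^{\mathrm{su}}_{jt}\le\sum_{t'\in\mathcal T^{\mathrm{supc}}_{jt}}p^{\mathrm{supc}}_{jtt'}u^{\mathrm{su}}_{jt'}$, $0\le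 p^{\mathrm{sd}}_{jt}\le\sum_{t'\in\mathcal T^{\mathrm{sdpc}}_{jt}}p^{\mathrm{sdpc}}_{jtt'}u^{\mathrm{sd}}_{jt'}$. **Penalties and subproblems.** The copied variables are $w=(p^{\mathrm{tot}},p^{\mathrm{su}},p^{\mathrm{sd}},q^{\mathrm{tot}},q^{\mathrm{res}},u^{\mathrm{on}},u^{\mathrm{sh}})\in\mathbb R^d$ ($d$ is their number). For $\ell\in\{1,2\}$, $\Gamma_\ell(p,q,u,\overline p,\overline q,\overline u)=\|w-\overline w\|_\ell^\ell$; $\Gamma'_\ell$ is the same with the $u^{\mathrm{sh}}$ entries dropped; with subscripted arguments only the corresponding entries are used. The overlined block consists of the device variables and $\overline u^{\mathrm{sh}}$. $Z^{\mathrm T}_t(\overline p_t,\overline q_t,\overline u_t;\rho)$: maximize $R^{\mathrm T}_t(p_t,q_t)-\rho\Gamma_2(p_t,q_t,u_t,\overline p_t,\overline q_t,\overline u_t)$ over $(p_t,q_t,u^{\mathrm{sh}}_t)\in\mathcal X^{\mathrm{ac}}_t$, $(p_{jt},q_{jt},u^{\mathrm{on}}_{jt})\in\mathcal Y^{\mathrm{uc}}_{jt}$ ($j\in\mathcal J^{\mathrm{sd}}$), $u^{\mathrm{sh}}_{jt}\in\mathcal Y^{\mathrm{sh}}_{jt}$ ($j\in\mathcal J^{\mathrm{sh}}$). $Z^{\mathrm J}_j(p_j,q_j,u_j;\rho)$: maximize $R^{\mathrm J}_j(\overline p_j,\overline u_j)-\rho\Gamma'_1(p_j,q_j,u_j,\overline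 p_j,\overline q_j,\overline u_j)$ over $(\overline p_j,\overline q_j,\overline u_j)\in\mathcal X^{\mathrm{uc}}_j$. $Z^{\mathrm{SH}}_{jt}(u^{\mathrm{sh}}_{jt})=\lfloor\frac12+\mathrm{proj}_{[u^{\mathrm{sh,min}}_j,u^{\mathrm{sh,max}}_j]}(u^{\mathrm{sh}}_{jt})\rfloor$. **Basic penalty alternating direction method.** For $\tau=1,\dots,\overline\tau$: (i) for each $t$, solve $Z^{\mathrm T}_t(0,0,0;0)$ if $\tau=1$, and $Z^{\mathrm T}_t(\overline p^{(\tau-1)}_t,\overline q^{(\tau-1)}_t,\overline u^{(\tau-1)}_t;\rho_\tau)$ if $\tau>1$, obtaining a feasible point $(p^{(\tau)}_t,q^{(\tau)}_t,u^{(\tau)}_t)$; (ii) for each $j\in\mathcal J^{\mathrm{sd}}$ solve $Z^{\mathrm J}_j(p^{(\tau)}_j,q^{(\tau)}_j,u^{(\tau)}_j;\rho_\tau)$, obtaining a feasible point $(\overline p^{(\tau)}_j,\overline q^{(\tau)}_j,\overline u^{(\tau)}_j)$; (iii) set $\overline u^{\mathrm{sh}(\tau)}_{jt}=Z^{\mathrm{SH}}_{jt}(u^{\mathrm{sh}(\tau)}_{jt})$ for $j\in\mathcal J^{\mathrm{sh}}$, $t\in\mathcal T$. **Stationarity.** $Z^{\mathrm T}_t$ is solved to stationarity if the returned feasible point, together with some values of the auxiliary variables $(v_t,\Delta_t,\theta_t,\tau_t,\phi_t)$ and $(u^{\mathrm{su}}_j,u^{\mathrm{sd}}_j)_j$,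 satisfies the Karush–Kuhn–Tucker conditions for the explicit equality/inequality description of the problem: for some (super)gradient of the objective and some multipliers (nonnegative for inequalities), the Lagrangian stationarity equation and complementary slackness hold. **Constants.** $D_t$ is the diameter (Euclidean) of the bounded feasible region of $Z^{\mathrm T}_t$ in the variables $(p_t,q_t,u^{\mathrm{on}}_t,u^{\mathrm{sh}}_t)$. $L_t$ is a Lipschitz constant of $R^{\mathrm T}_t$ on this region, such that every (super)gradient of $R^{\mathrm T}_t$ at points of the region has Euclidean norm at most $L_t$. $R_j$ is the maximum difference of values of $R^{\mathrm J}_j$ over the feasible region $\mathcal X^{\mathrm{uc}}_j$, and $R=\sum_{j\in\mathcal J^{\mathrm{sd}}}R_j$. *)

(* Defs.v *)
From HB Require Import structures.
From mathcomp Require Import all_boot all_order all_algebra.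
From mathcomp Require Import all_classical all_reals all_analysis.
Import Order.TTheory GRing.Theory Num.Theory.
Import numFieldNormedType.Exports.

Set Implicit Arguments.
Unset Strict Implicit.
Unset Printing Implicit Defensive.

Local Open Scope classical_set_scope.
Local Open Scope ring_scope.

Section Generic.
Variable R : realType.

Definition pos_part (x : R) : R := Num.max x 0.

(* Maximum of a finite family; the value for the empty family is the
   convention 0. *)
Definition seq_max (s : seq R) : R := \big[Num.max/head 0 s]_(x <- s) x.

Definition norm2 (a b : R) : R := Num.sqrt (a ^+ 2 + b ^+ 2).

Definition eucl_norm (V : finType) (x : V -> R) : R :=
  Num.sqrt (\sum_c x c ^+ 2).

Definition supergradient (V : finType) (f : (V -> R) -> R) (x g : V -> R) :=
  forall y, f y <= f x + \sum_c g c * (y c - x c).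

Definition partial (V : eqType) (f : (V -> R) -> R) (x : V -> R) (c : V) : R :=
  derive1 (fun s : R => f (fun c' => if c' == c then s else x c') : R^o) (x c).

(* f is affine on every segment whose interior avoids a finite set of
   breakpoints. *)
Definition piecewise_linear (f : R -> R) :=
  exists s : seq R, forall a b, a <= b ->
    (forall c, c \in s -> ~ (a < c < b)) ->
    exists m k, forall x, a <= x <= b -> f x = m * x + k.

Definition convex (f : R -> R) := @convex_function R R^o setT f.
Definition concave (f : R -> R) := @convex_function R R^o setT (fun x => - f x).

(* A constraint [resid x = 0] (if [is_eqn]) or [resid x <= 0]. *)
Record constr (V : Type) := Constr { is_eqn : bool; resid : (V -> R) -> R }.

Definition holds (V : Type) (c : constr V) (x : V -> R) : bool :=
  if is_eqn c then resid c x == 0 else resid c x <= 0.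

Definition sat (V : Type) (cs : seq (constr V)) (x : V -> R) : bool :=
  all (fun c => holds c x) cs.

(* The constraints on V, imposed on the coordinates e v of a point of W. *)
Definition pullback (V W : Type) (e : V -> W) (cs : seq (constr V)) :
    seq (constr W) :=
  [seq Constr (is_eqn c) (fun x => resid c (fun v => x (e v))) | c <- cs].

(* Karush-Kuhn-Tucker conditions at x for maximizing the concave function obj
   under the constraints cs; lam k is the multiplier of the k-th constraint. *)
Definition KKT (V : finType) (obj : (V -> R) -> R) (cs : seq (constr V))
    (x : V -> R) :=
  let c0 := Constr true (fun _ : V -> R => 0) in
  sat cs x /\
  exists (g : V -> R) (lam : nat -> R),
    [/\ supergradient obj x g,
        (forall k, (k < size cs)%N -> ~~ is_eqn (nth c0 cs k) ->
           0 <= lam k /\ lam k * resid (nth c0 cs k) x = 0)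
      & (forall v, g v =
           \sum_(k < size cs) lam k * partial (resid (nth c0 cs k)) x v)].

(* A finite intersection of half-spaces  sum_v r.1 v * x v <= r.2. *)
Definition polyhedron (V : finType) := seq ({ffun V -> R} * R).

Definition poly_cstr (V : finType) (P : polyhedron V) : seq (constr V) :=
  [seq Constr false (fun x : V -> R => \sum_v r.1 v * x v - r.2)
  | r : {ffun V -> R} * R <- P].

Definition in_poly (V : finType) (P : polyhedron V) (x : V -> R) : bool :=
  sat (poly_cstr P) x.

(* A constant, or a multiple of the sum or of the maximum over a set N of
   devices of their p^tot (respectively q^tot) in the period. *)
Inductive requirement :=
  | ReqConst of R
  | ReqSum of R
  | ReqMax of R.

Definition req_ok (q : requirement) : Prop :=
  match q with ReqConst _ => True | ReqSum a => 0 <= a | ReqMax a => 0 <= a end.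

Definition req_val (J : finType) (q : requirement) (N : {set J}) (x : J -> R) :
    R :=
  match q with
  | ReqConst a => a
  | ReqSum a => a * \sum_(j in N) x j
  | ReqMax a => a * seq_max [seq x j | j <- enum N]
  end.

End Generic.

Notation "[ 'eq' x : V | a = b ]" := (Constr true (fun x : V -> _ => a - b))
  (at level 0, x name, V at level 200, a at level 69, b at level 69).
Notation "[ 'le' x : V | a <= b ]" := (Constr false (fun x : V -> _ => a - b))
  (at level 0, x name, V at level 200, a at level 69, b at level 69).

(* Coordinates of the space containing X^p_jt. *)
Inductive pcoord (P : Type) := CUon | CPtot | CPon | CPres of P.
Arguments CUon {P}.
Arguments CPtot {P}.
Arguments CPon {P}.

Section PcoordFin.
Variable P : Type.
Definition pcoord_code (c : pcoord P) : unit + unit + unit + P :=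
  match c with
  | CUon => inl (inl (inl tt)) | CPtot => inl (inl (inr tt))
  | CPon => inl (inr tt) | CPres r => inr r
  end.
Definition pcoord_decode (c : unit + unit + unit + P) : pcoord P :=
  match c with
  | inl (inl (inl _)) => CUon | inl (inl (inr _)) => CPtot
  | inl (inr _) => CPon | inr r => CPres r
  end.
Lemma pcoord_codeK : cancel pcoord_code pcoord_decode.
Proof. by case. Qed.
End PcoordFin.
HB.instance Definition _ (P : finType) :=
  Finite.copy (pcoord P) (can_type (@pcoord_codeK P)).

(* Time periods are 0, ..., nT - 1; the data uon0 and ptot0 precede the first
   one.  Devices are Jpr + Jcs and branches are Jac + Jdc.  For reactive
   reserves, true stands for the up product and false for the down product. *)
Record grid (R : realType) := Grid {
  nT : nat;
  bus : finType;
  Jpr : finType;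
  Jcs : finType;
  Jac : finType;
  Jdc : finType;
  Jsh : finType;
  rprod : finType;

  dur : 'I_nT -> R;
  dev_bus : (Jpr + Jcs)%type -> bus;
  sh_bus : Jsh -> bus;
  br_fr : (Jac + Jdc)%type -> bus;
  br_to : (Jac + Jdc)%type -> bus;

  uon0 : (Jpr + Jcs)%type -> bool;
  ptot0 : (Jpr + Jcs)%type -> R;
  psupc : (Jpr + Jcs)%type -> 'I_nT -> 'I_nT -> R;
  psdpc : (Jpr + Jcs)%type -> 'I_nT -> 'I_nT -> R;
  (* coordinates: u^on_t, then u^su_t, then u^sd_t *)
  Xu : (Jpr + Jcs)%type -> polyhedron R ('I_nT + 'I_nT + 'I_nT)%type;
  Xp : (Jpr + Jcs)%type -> 'I_nT -> polyhedron R (pcoord rprod);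
  qmax : (Jpr + Jcs)%type -> 'I_nT -> R;
  qmin : (Jpr + Jcs)%type -> 'I_nT -> R;
  betamax : (Jpr + Jcs)%type -> R;
  betamin : (Jpr + Jcs)%type -> R;
  pru : (Jpr + Jcs)%type -> R;
  prd : (Jpr + Jcs)%type -> R;
  prusu : (Jpr + Jcs)%type -> R;
  prdsd : (Jpr + Jcs)%type -> R;

  g_end : bus -> Jac -> R;
  b_end : bus -> Jac -> R;
  g_br : Jac -> R;
  b_br : Jac -> R;
  g_sh : Jsh -> R;
  b_sh : Jsh -> R;
  vmin : bus -> R;
  vmax : bus -> R;
  phimin : Jac -> R;
  phimax : Jac -> R;
  taumin : Jac -> R;
  taumax : Jac -> R;
  pdcmax : Jdc -> R;
  qfrmin : Jdc -> R;
  qfrmax : Jdc -> R;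
  qtomin : Jdc -> R;
  qtomax : Jdc -> R;
  ushmin : Jsh -> int;
  ushmax : Jsh -> int;

  c_on : (Jpr + Jcs)%type -> 'I_nT -> R;
  c_su : (Jpr + Jcs)%type -> R;
  c_sd : (Jpr + Jcs)%type -> R;
  c_dd : (Jpr + Jcs)%type -> 'I_nT -> 'I_nT -> R;
  c_e : R;
  Wmin : (Jpr + Jcs)%type -> {set {set 'I_nT}};
  Wmax : (Jpr + Jcs)%type -> {set {set 'I_nT}};
  emin : (Jpr + Jcs)%type -> {set 'I_nT} -> R;
  emax : (Jpr + Jcs)%type -> {set 'I_nT} -> R;
  Cpow : Jpr -> 'I_nT -> R -> R;
  Rpow : Jcs -> 'I_nT -> R -> R;

  Np : {set {set (Jpr + Jcs)%type}};
  Nq : {set {set (Jpr + Jcs)%type}};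
  c_presj : (Jpr + Jcs)%type -> 'I_nT -> rprod -> R;
  c_pres : {set rprod} -> R;
  p_req : 'I_nT -> {set rprod} -> {set (Jpr + Jcs)%type} -> requirement R;
  c_qresj : (Jpr + Jcs)%type -> 'I_nT -> bool -> R;
  c_qres : bool -> R;
  q_req : 'I_nT -> bool -> {set (Jpr + Jcs)%type} -> requirement R;

  c_s : R;
  c_p : R;
  c_q : R;
  smax : Jac -> R;
  nK : nat;
  ctg_br : 'I_nK -> Jac;
  ctg_F : 'I_nK -> Jac -> bus -> R;
  smaxctg : Jac -> R
}.

Notation Jsd G := (Jpr G + Jcs G)%type.
Notation Jbr G := (Jac G + Jdc G)%type.
Notation time G := 'I_(nT G).

(* Variables of one device in one period, except u^su and u^sd. *)
Inductive dvar (R : realType) (G : grid R) : Type :=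
  | Ptot | Pon | Psu | Psd | Pres of rprod G | Qtot | Qres of bool | Uon.
Arguments Ptot {R G}.
Arguments Pon {R G}.
Arguments Psu {R G}.
Arguments Psd {R G}.
Arguments Qtot {R G}.
Arguments Qres {R G}.
Arguments Uon {R G}.

(* Period-t entries, except u^su and u^sd, of the block that the device
   subproblems and the shunt rounding determine. *)
Inductive bvar (R : realType) (G : grid R) : Type :=
  | Dev of Jsd G & dvar G | Ush of Jsh G.

Inductive nvar (R : realType) (G : grid R) : Type :=
  | Pfr of Jbr G | Pto of Jbr G | Qfr of Jbr G | Qto of Jbr G
  | Psh of Jsh G | Qsh of Jsh G.

(* (p_t, q_t, u^on_t, u^sh_t) *)
Inductive xvar (R : realType) (G : grid R) : Type :=
  | Blk of bvar G | Net of nvar G.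

(* Auxiliary variables of the period-t problem; each period-t problem has its
   own copy of (u^su_j, u^sd_j) over the whole horizon. *)
Inductive avar (R : realType) (G : grid R) : Type :=
  | Vm of bus G | Theta of bus G | Delta of Jac G | Tap of Jac G | Phi of Jac G
  | Usu of Jsd G & time G | Usd of Jsd G & time G.

Inductive zvar (R : realType) (G : grid R) : Type :=
  | Main of xvar G | Aux of avar G.

(* (p_jt, q_jt, u^on_jt) together with (u^su_j, u^sd_j) *)
Inductive lvar (R : realType) (G : grid R) : Type :=
  | Loc of dvar G | Lsu of time G | Lsd of time G.
Arguments Lsu {R G}.
Arguments Lsd {R G}.

Coercion Blk : bvar >-> xvar.
Coercion Net : nvar >-> xvar.
Coercion Main : xvar >-> zvar.
Coercion Aux : avar >-> zvar.
Coercion Loc : dvar >-> lvar.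

Section VarFin.
Variables (R : realType) (G : grid R).

Definition dvar_code (v : dvar G) :
    unit + unit + unit + unit + rprod G + unit + bool + unit :=
  match v with
  | Ptot => inl (inl (inl (inl (inl (inl (inl tt))))))
  | Pon => inl (inl (inl (inl (inl (inl (inr tt))))))
  | Psu => inl (inl (inl (inl (inl (inr tt)))))
  | Psd => inl (inl (inl (inl (inr tt))))
  | Pres r => inl (inl (inl (inr r)))
  | Qtot => inl (inl (inr tt))
  | Qres b => inl (inr b)
  | Uon => inr tt
  end.
Definition dvar_decode
    (c : unit + unit + unit + unit + rprod G + unit + bool + unit) : dvar G :=
  match c with
  | inl (inl (inl (inl (inl (inl (inl _)))))) => Ptot
  | inl (inl (inl (inl (inl (inl (inr _)))))) => Pon
  | inl (inl (inl (inl (inl (inr _))))) => Psu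
  | inl (inl (inl (inl (inr _)))) => Psd
  | inl (inl (inl (inr r))) => Pres r
  | inl (inl (inr _)) => Qtot
  | inl (inr b) => Qres b
  | inr _ => Uon
  end.
Lemma dvar_codeK : cancel dvar_code dvar_decode.
Proof. by case. Qed.
HB.instance Definition _ := Finite.copy (dvar G) (can_type dvar_codeK).

Definition bvar_code (v : bvar G) : Jsd G * dvar G + Jsh G :=
  match v with Dev j v => inl (j, v) | Ush h => inr h end.
Definition bvar_decode (c : Jsd G * dvar G + Jsh G) : bvar G :=
  match c with inl (j, v) => Dev j v | inr h => Ush h end.
Lemma bvar_codeK : cancel bvar_code bvar_decode.
Proof. by case. Qed.
HB.instance Definition _ := Finite.copy (bvar G) (can_type bvar_codeK).

Definition nvar_code (v : nvar G) :
    Jbr G + Jbr G + Jbr G + Jbr G + Jsh G + Jsh G :=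
  match v with
  | Pfr l => inl (inl (inl (inl (inl l)))) | Pto l => inl (inl (inl (inl (inr l))))
  | Qfr l => inl (inl (inl (inr l))) | Qto l => inl (inl (inr l))
  | Psh h => inl (inr h) | Qsh h => inr h
  end.
Definition nvar_decode (c : Jbr G + Jbr G + Jbr G + Jbr G + Jsh G + Jsh G) :
    nvar G :=
  match c with
  | inl (inl (inl (inl (inl l)))) => Pfr l | inl (inl (inl (inl (inr l)))) => Pto l
  | inl (inl (inl (inr l))) => Qfr l | inl (inl (inr l)) => Qto l
  | inl (inr h) => Psh h | inr h => Qsh h
  end.
Lemma nvar_codeK : cancel nvar_code nvar_decode.
Proof. by case. Qed.
HB.instance Definition _ := Finite.copy (nvar G) (can_type nvar_codeK).

Definition xvar_code (v : xvar G) : bvar G + nvar G :=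
  match v with Blk c => inl c | Net c => inr c end.
Definition xvar_decode (c : bvar G + nvar G) : xvar G :=
  match c with inl c => Blk c | inr c => Net c end.
Lemma xvar_codeK : cancel xvar_code xvar_decode.
Proof. by case. Qed.
HB.instance Definition _ := Finite.copy (xvar G) (can_type xvar_codeK).

Definition avar_code (v : avar G) :
    bus G + bus G + Jac G + Jac G + Jac G + Jsd G * time G + Jsd G * time G :=
  match v with
  | Vm i => inl (inl (inl (inl (inl (inl i)))))
  | Theta i => inl (inl (inl (inl (inl (inr i)))))
  | Delta j => inl (inl (inl (inl (inr j))))
  | Tap j => inl (inl (inl (inr j)))
  | Phi j => inl (inl (inr j))
  | Usu j s => inl (inr (j, s))
  | Usd j s => inr (j, s)
  end.
Definition avar_decode
    (c : bus G + bus G + Jac G + Jac G + Jac G + Jsd G * time G + Jsd G * time G) :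
    avar G :=
  match c with
  | inl (inl (inl (inl (inl (inl i))))) => Vm i
  | inl (inl (inl (inl (inl (inr i))))) => Theta i
  | inl (inl (inl (inl (inr j)))) => Delta j
  | inl (inl (inl (inr j))) => Tap j
  | inl (inl (inr j)) => Phi j
  | inl (inr (j, s)) => Usu j s
  | inr (j, s) => Usd j s
  end.
Lemma avar_codeK : cancel avar_code avar_decode.
Proof. by case. Qed.
HB.instance Definition _ := Finite.copy (avar G) (can_type avar_codeK).

Definition zvar_code (v : zvar G) : xvar G + avar G :=
  match v with Main c => inl c | Aux c => inr c end.
Definition zvar_decode (c : xvar G + avar G) : zvar G :=
  match c with inl c => Main c | inr c => Aux c end.
Lemma zvar_codeK : cancel zvar_code zvar_decode.
Proof. by case. Qed.
HB.instance Definition _ := Finite.copy (zvar G) (can_type zvar_codeK).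

End VarFin.

(* A full-horizon device point (p_j, q_j, u_j). *)
Record dtraj (R : realType) (G : grid R) := DTraj {
  dval : time G -> dvar G -> R;
  dsu : time G -> R;
  dsd : time G -> R
}.

Section Model.
Variables (R : realType) (G : grid R).
Implicit Types (j : Jsd G) (t : time G).

(* Value in the preceding period, x0 before the first one. *)
Definition prev (x0 : R) (x : time G -> R) t : R :=
  if (t : nat) == 0%N then x0 else x (ord_pred t).

Definition Tsupc j t : pred (time G) :=
  fun t' => (t < t')%N && (0 < psupc j t t').
Definition Tsdpc j t : pred (time G) :=
  fun t' => (t' <= t)%N && (0 < psdpc j t t').

Definition binary (x : R) := x = 0 \/ x = 1.

Definition U_cons j (uon usu usd : time G -> R) :=
  [/\ forall t, uon t - prev (uon0 j)%:R uon t = usu t - usd t,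
      forall t, usu t + usd t <= 1,
      in_poly (Xu j) (fun c => match c with
                               | inl (inl t) => uon t
                               | inl (inr t) => usu t
                               | inr t => usd t
                               end)
    & forall t, [/\ binary (uon t), binary (usu t) & binary (usd t)]].

Definition P1_cstr : seq (constr R (lvar G)) :=
  [:: [eq l : lvar G | l Ptot = l Pon + l Psu + l Psd]].

Definition P3_coord (c : pcoord (rprod G)) : lvar G :=
  match c with
  | CUon => Uon | CPtot => Ptot | CPon => Pon | CPres r => Pres r
  end.

Definition P3_cstr j t : seq (constr R (lvar G)) :=
  pullback P3_coord (poly_cstr (Xp j t)).

Definition P4_cstr : seq (constr R (lvar G)) :=
  [:: [le l : lvar G | 0 <= l Ptot]; [le l : lvar G | 0 <= l Pon]] ++
  [seq [le l : lvar G | 0 <= l (Pres r)] | r <- enum (rprod G)].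

Definition sigma j t (l : lvar G -> R) : R :=
  l Uon + \sum_(t' | Tsupc j t t') l (Lsu t')
        + \sum_(t' | Tsdpc j t t') l (Lsd t').

Definition producing j : bool := if j is inl _ then true else false.

Definition Q_cstr j t : seq (constr R (lvar G)) :=
  let a := producing j in
  [:: [le l : lvar G | l Qtot <= qmax j t * sigma j t l + betamax j * l Ptot - l (Qres a)];
      [le l : lvar G | qmin j t * sigma j t l + betamin j * l Ptot + l (Qres (~~ a))
              <= l Qtot];
      [le l : lvar G | 0 <= l (Qres true)];
      [le l : lvar G | 0 <= l (Qres false)]].

Definition S_cons j (uon usu usd : time G -> R) :=
  forall t, uon t + \sum_(t' | Tsupc j t t') usu t' <= 1 /\
            uon t + \sum_(t' | Tsdpc j t t') usd t' <= 1.

Definition S_cstr j t : seq (constr R (lvar G)) :=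
  [:: [le l : lvar G | l Uon + \sum_(t' | Tsupc j t t') l (Lsu t') <= 1];
      [le l : lvar G | l Uon + \sum_(t' | Tsdpc j t t') l (Lsd t') <= 1]].

Definition lpoint (z : dvar G -> R) (usu usd : time G -> R) : lvar G -> R :=
  fun c => match c with Loc v => z v | Lsu t => usu t | Lsd t => usd t end.

Definition P2_cons j (y : dtraj G) :=
  forall t,
    dval y t Psu = \sum_(t' | Tsupc j t t') psupc j t t' * dsu y t' /\
    dval y t Psd = \sum_(t' | Tsdpc j t t') psdpc j t t' * dsd y t'.

Definition R_cons j (y : dtraj G) :=
  forall t,
    let uon := dval y t Uon in
    let ramp := dval y t Ptot - prev (ptot0 j) (fun s => dval y s Ptot) t in
    - dur t * (prd j * uon + prdsd j * (1 - uon)) <= ramp /\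
    ramp <= dur t * (pru j * (uon - dsu y t) + prusu j * (dsu y t - uon + 1)).

Definition Xuc j : set (dtraj G) := [set y |
  [/\ U_cons j (fun t => dval y t Uon) (dsu y) (dsd y),
      P2_cons j y,
      R_cons j y
    & forall t, sat (P1_cstr ++ P3_cstr j t ++ P4_cstr ++ Q_cstr j t)
                    (lpoint (dval y t) (dsu y) (dsd y))]].

Definition Yuc_cstr j t : seq (constr R (lvar G)) :=
  P1_cstr ++ P3_cstr j t ++ P4_cstr ++ Q_cstr j t ++ S_cstr j t ++
  [:: [le l : lvar G | 0 <= l Psu];
      [le l : lvar G | l Psu <= \sum_(t' | Tsupc j t t') psupc j t t' * l (Lsu t')];
      [le l : lvar G | 0 <= l Psd];
      [le l : lvar G | l Psd <= \sum_(t' | Tsdpc j t t') psdpc j t t' * l (Lsd t')];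
      [le l : lvar G | 0 <= l Uon]] ++
  flatten [seq [:: [le l : lvar G | 0 <= l (Lsu t')]; [le l : lvar G | l (Lsu t') <= 1];
                   [le l : lvar G | 0 <= l (Lsd t')]; [le l : lvar G | l (Lsd t') <= 1]]
          | t' <- enum (time G)].

Definition Yuc j t : set (dvar G -> R) := [set z |
  exists usu usd, sat (Yuc_cstr j t) (lpoint z usu usd)].

Definition box_cstr (c : zvar G) (lo hi : R) : seq (constr R (zvar G)) :=
  [:: [le z : zvar G | lo <= z c]; [le z : zvar G | z c <= hi]].

Definition F1_cstr : seq (constr R (zvar G)) :=
  flatten [seq
    let e : Jbr G := inl j in
    let i := br_fr e in
    let i' := br_to e in
    [:: [eq z : zvar G | z (Delta j) = z (Theta i) - z (Theta i') - z (Phi j)];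
        [eq z : zvar G | z (Pfr e) =
          z (Vm i) * (g_end i j * z (Vm i) / z (Tap j) ^+ 2
            + z (Vm i') / z (Tap j)
              * (- g_br j * cos (z (Delta j)) - b_br j * sin (z (Delta j))))];
        [eq z : zvar G | z (Pto e) =
          z (Vm i') * (g_end i' j * z (Vm i')
            + z (Vm i) / z (Tap j)
              * (- g_br j * cos (z (Delta j)) + b_br j * sin (z (Delta j))))];
        [eq z : zvar G | z (Qfr e) =
          z (Vm i) * (- b_end i j * z (Vm i) / z (Tap j) ^+ 2
            + z (Vm i') / z (Tap j)
              * (b_br j * cos (z (Delta j)) - g_br j * sin (z (Delta j))))];
        [eq z : zvar G | z (Qto e) =
          z (Vm i') * (- b_end i' j * z (Vm i')
            + z (Vm i) / z (Tap j)
              * (b_br j * cos (z (Delta j)) + g_br j * sin (z (Delta j))))]]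
  | j : Jac G <- enum (Jac G)].

Definition F2_cstr : seq (constr R (zvar G)) :=
  [seq [eq z : zvar G | z (Pfr (inr j)) + z (Pto (inr j)) = 0]
  | j : Jdc G <- enum (Jdc G)] ++
  flatten [seq
    [:: [eq z : zvar G | z (Psh h) = g_sh h * z (Ush h) * z (Vm (sh_bus h)) ^+ 2];
        [eq z : zvar G | z (Qsh h) = - b_sh h * z (Ush h) * z (Vm (sh_bus h)) ^+ 2]]
  | h <- enum (Jsh G)].

Definition F3_cstr : seq (constr R (zvar G)) :=
  flatten [seq box_cstr (Vm i) (vmin i) (vmax i) | i <- enum (bus G)] ++
  flatten [seq box_cstr (Phi j) (phimin j) (phimax j) ++
               box_cstr (Tap j) (taumin j) (taumax j) | j : Jac G <- enum (Jac G)] ++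
  flatten [seq box_cstr (Pfr (inr j)) (- pdcmax j) (pdcmax j) ++
               box_cstr (Pto (inr j)) (- pdcmax j) (pdcmax j) ++
               box_cstr (Qfr (inr j)) (qfrmin j) (qfrmax j) ++
               box_cstr (Qto (inr j)) (qtomin j) (qtomax j)
          | j : Jdc G <- enum (Jdc G)].

Definition ac_cstr := F1_cstr ++ F2_cstr ++ F3_cstr.

Definition zpoint (x : xvar G -> R) (a : avar G -> R) : zvar G -> R :=
  fun c => match c with Main v => x v | Aux v => a v end.

(* The network data do not depend on the period, so neither does this set. *)
Definition Xac : set (xvar G -> R) := [set x | exists a, sat ac_cstr (zpoint x a)].

Definition Xsh (h : Jsh G) : set R := [set u |
  (ushmin h)%:~R <= u <= (ushmax h)%:~R /\ exists n : nat, u = n%:R].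

Definition Ysh_cstr : seq (constr R (zvar G)) :=
  flatten [seq box_cstr (Ush h) (ushmin h)%:~R (ushmax h)%:~R | h <- enum (Jsh G)].

Definition Ysh (h : Jsh G) : set R :=
  [set u | (ushmin h)%:~R <= u <= (ushmax h)%:~R].

Definition Cuc j (y : dtraj G) : R :=
  \sum_t (c_on j t * dval y t Uon + c_su j * dsu y t + c_sd j * dsd y t
          - \sum_(t' : time G | (t' < t)%N)
              c_dd j t t' * pos_part (dsu y t + dval y t' Uon - 1)).

Definition Cen j (y : dtraj G) : R :=
  c_e G * (\sum_(W in Wmin j)
             pos_part (emin j W - \sum_(t in W) dur t * dval y t Ptot)
         + \sum_(W in Wmax j)
             pos_part (- emax j W + \sum_(t in W) dur t * dval y t Ptot)).

Definition RJ j (y : dtraj G) : R :=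
  - Cuc j y - Cen j y +
  match j with
  | inl i => - \sum_t Cpow i t (dval y t Ptot)
  | inr i => \sum_t Rpow i t (dval y t Ptot)
  end.

Definition Cres t (x : xvar G -> R) : R :=
  dur t * (
    \sum_j \sum_r c_presj j t r * x (Dev j (Pres r))
  + \sum_(R' : {set rprod G}) c_pres R' * \sum_(N in Np G)
      pos_part (req_val (p_req t R' N) N (fun j => x (Dev j Ptot))
                - \sum_(r in R') \sum_(j in N) x (Dev j (Pres r)))
  + \sum_(r : bool) (
      \sum_j c_qresj j t r * x (Dev j (Qres r))
      + c_qres G r * \sum_(N in Nq G)
          pos_part (req_val (q_req t r N) N (fun j => x (Dev j Qtot))
                    - \sum_(j in N) x (Dev j (Qres r))))).

Definition Cac t (e : Jac G) (x : xvar G -> R) : R :=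
  c_s G * dur t * pos_part
    (Num.max (norm2 (x (Pfr (inl e))) (x (Qfr (inl e))))
             (norm2 (x (Pto (inl e))) (x (Qto (inl e)))) - smax e).

Definition dev_inj (xtot : Jsd G -> R) (xsh : Jsh G -> R) (i : bus G) : R :=
  \sum_(j : Jpr G | dev_bus (inl j) == i) xtot (inl j)
  - \sum_(j : Jcs G | dev_bus (inr j) == i) xtot (inr j)
  - \sum_(h | sh_bus h == i) xsh h.

Definition balance (xtot : Jsd G -> R) (xsh : Jsh G -> R) (xfr xto : Jbr G -> R)
    (i : bus G) : R :=
  dev_inj xtot xsh i - \sum_(l | br_fr l == i) xfr l - \sum_(l | br_to l == i) xto l.

Definition Bp (x : xvar G -> R) : bus G -> R :=
  balance (fun j => x (Dev j Ptot)) (fun h => x (Psh h))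
          (fun l => x (Pfr l)) (fun l => x (Pto l)).

Definition Bq (x : xvar G -> R) : bus G -> R :=
  balance (fun j => x (Dev j Qtot)) (fun h => x (Qsh h))
          (fun l => x (Qfr l)) (fun l => x (Qto l)).

Definition Cbal t (i : bus G) (x : xvar G -> R) : R :=
  dur t * (c_p G * `|Bp x i| + c_q G * `|Bq x i|).

Definition pinj (x : xvar G -> R) (i : bus G) : R :=
  dev_inj (fun j => x (Dev j Ptot)) (fun h => x (Psh h)) i
  - \sum_(l : Jdc G | br_fr (inr l) == i) x (Pfr (inr l))
  - \sum_(l : Jdc G | br_to (inr l) == i) x (Pto (inr l)).

Definition ctg_flow (k : 'I_(nK G)) (e : Jac G) (x : xvar G -> R) : R :=
  \sum_i ctg_F k e i * (pinj x i - (#|bus G|%:R)^-1 * \sum_i' pinj x i').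

Definition Cctgk (k : 'I_(nK G)) t (x : xvar G -> R) : R :=
  c_s G * dur t * \sum_(e | e != ctg_br k)
    pos_part (norm2 (ctg_flow k e x)
                (Num.max `|x (Qfr (inl e))| `|x (Qto (inl e))|) - smaxctg e).

Definition Cctg t (x : xvar G -> R) : R :=
  ((nK G)%:R)^-1 * \sum_k Cctgk k t x
  + seq_max [seq Cctgk k t x | k <- enum 'I_(nK G)].

Definition RT t (x : xvar G -> R) : R :=
  - Cres t x - Cctg t x - \sum_e Cac t e x - \sum_i Cbal t i x.

Record grid_ok : Prop := GridOk {
  dur_gt0 : forall t, 0 < dur t;
  psupc_ge0 : forall j t t', 0 <= psupc j t t';
  psdpc_ge0 : forall j t t', 0 <= psdpc j t t';
  v_bounds_gt0 : forall i : bus G, 0 < vmin i /\ 0 < vmax i;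
  tap_bounds_gt0 : forall e : Jac G, 0 < taumin e /\ 0 < taumax e;
  c_su_ge0 : forall j, 0 <= c_su j;
  c_sd_ge0 : forall j, 0 <= c_sd j;
  c_dd_ge0 : forall j t t', 0 <= c_dd j t t';
  c_e_ge0 : 0 <= c_e G;
  Cpow_ok : forall (j : Jpr G) t, convex (Cpow j t) /\ piecewise_linear (Cpow j t);
  Rpow_ok : forall (j : Jcs G) t, concave (Rpow j t) /\ piecewise_linear (Rpow j t);
  c_pres_ge0 : forall R' : {set rprod G}, 0 <= c_pres R';
  c_qres_ge0 : forall r : bool, 0 <= c_qres G r;
  p_req_ok : forall t R' N, req_ok (p_req t R' N);
  q_req_ok : forall t r N, req_ok (q_req t r N);
  c_s_ge0 : 0 <= c_s G;
  c_p_ge0 : 0 <= c_p G;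
  c_q_ge0 : 0 <= c_q G;
  nK_gt0 : (0 < nK G)%N
}.

Definition full_feasible (x : time G -> xvar G -> R)
    (usu usd : Jsd G -> time G -> R) :=
  [/\ forall j, Xuc j (DTraj (fun t v => x t (Dev j v)) (usu j) (usd j)),
      forall t, Xac (x t)
    & forall h t, Xsh h (x t (Ush h))].

Definition full_obj (x : time G -> xvar G -> R) (usu usd : Jsd G -> time G -> R) :
    R :=
  \sum_t RT t (x t)
  + \sum_j RJ j (DTraj (fun t v => x t (Dev j v)) (usu j) (usd j)).

(* Closedness, convexity and polyhedrality of the sets X^p_jt are built into the
   type of [Xp]. The optimal value is a supremum in the extended reals. *)
Record standing_assumption : Prop := StandingAssumption {
  startup_cost : forall j t, \sum_(t' : time G | (t' < t)%N) c_dd j t t' <= c_su j;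
  U_implies_S : forall j uon usu usd, U_cons j uon usu usd -> S_cons j uon usu usd;
  Xp_bounded : forall j t, exists M : R, forall z,
    in_poly (Xp j t) z -> forall c, `|z c| <= M;
  full_problem_feasible : exists x usu usd, full_feasible x usu usd;
  full_problem_ge0 :
    (0 <= ereal_sup [set v : \bar R | exists x usu usd,
                       full_feasible x usu usd /\ v = (full_obj x usu usd)%:E])%E
}.

Definition copied_dev (v : dvar G) : bool :=
  match v with Pon => false | Pres _ => false | _ => true end.

Definition copied (c : bvar G) : bool :=
  match c with Dev _ v => copied_dev v | Ush _ => true end.

(* The number of copied variables (p^tot, p^su, p^sd, q^tot, q^res, u^on, u^sh)
   over the whole horizon. *)
Definition dim_w : nat := (nT G * #|[pred c : bvar G | copied c]|)%N.

(* ||w - w'||_l^l over the copied entries of one period; of one device, over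
   the horizon; and over all copied entries. *)
Definition GammaT (l : nat) (b b' : bvar G -> R) : R :=
  \sum_(c | copied c) `|b c - b' c| ^+ l.

Definition GammaJ' (l : nat) (y y' : time G -> dvar G -> R) : R :=
  \sum_t \sum_(v | copied_dev v) `|y t v - y' t v| ^+ l.

Definition Gamma (l : nat) (b b' : time G -> bvar G -> R) : R :=
  \sum_t GammaT l (b t) (b' t).

Definition block (x : xvar G -> R) : bvar G -> R := fun c => x c.

Definition dev_part (x : time G -> xvar G -> R) j : time G -> dvar G -> R :=
  fun t v => x t (Dev j v).

Definition bar_block (y : Jsd G -> dtraj G) (ush : Jsh G -> time G -> R) t :
    bvar G -> R :=
  fun c => match c with Dev j v => dval (y j) t v | Ush h => ush h t end.

Definition ZT_feas t : set (xvar G -> R) := [set x |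
  [/\ Xac x,
      forall j, Yuc j t (fun v => x (Dev j v))
    & forall h, Ysh h (x (Ush h))]].

Definition ZT_obj t (b : bvar G -> R) (rho : R) (x : xvar G -> R) : R :=
  RT t x - rho * GammaT 2 (block x) b.

Definition dev_coord j (c : lvar G) : zvar G :=
  match c with Loc v => Dev j v | Lsu t => Usu j t | Lsd t => Usd j t end.

Definition ZT_cstr t : seq (constr R (zvar G)) :=
  ac_cstr
  ++ flatten [seq pullback (dev_coord j) (Yuc_cstr j t) | j <- enum {: Jsd G}]
  ++ Ysh_cstr.

Definition ZT_stationary t (b : bvar G -> R) (rho : R) (x : xvar G -> R) :=
  exists a : avar G -> R,
    KKT (fun z => ZT_obj t b rho (fun c => z (Main c))) (ZT_cstr t) (zpoint x a).

Definition ZJ_obj j (z : time G -> dvar G -> R) (rho : R) (y : dtraj G) : R :=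
  RJ j y - rho * GammaJ' 1 z (dval y).

Definition ZJ_optimal j (z : time G -> dvar G -> R) (rho : R) (y : dtraj G) :=
  Xuc j y /\ forall y', Xuc j y' -> ZJ_obj j z rho y' <= ZJ_obj j z rho y.

Definition ZSH (h : Jsh G) (u : R) : R :=
  (Num.floor (2^-1 + Num.max (ushmin h)%:~R (Num.min u (ushmax h)%:~R)))%:~R.

(* Iterates are indexed by 1, ..., taubar: x is (p, q, u^on, u^sh) and
   (y, ush) is the copy computed by the device subproblems and the rounding. *)
Definition ZT_arg (y : nat -> Jsd G -> dtraj G)
    (ush : nat -> Jsh G -> time G -> R) (tau : nat) t : bvar G -> R :=
  if tau == 1%N then fun=> 0 else bar_block (y tau.-1) (ush tau.-1) t.

Definition ZT_rho (rho : nat -> R) (tau : nat) : R :=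
  if tau == 1%N then 0 else rho tau.

Definition padm_iterates (taubar : nat)
    (x : nat -> time G -> xvar G -> R) (y : nat -> Jsd G -> dtraj G)
    (ush : nat -> Jsh G -> time G -> R) :=
  forall tau, (1 <= tau <= taubar)%N ->
    [/\ forall t, ZT_feas t (x tau t),
        forall j, Xuc j (y tau j)
      & forall h t, ush tau h t = ZSH h (x tau t (Ush h))].

Definition ZT_all_stationary (taubar : nat) (rho : nat -> R)
    (x : nat -> time G -> xvar G -> R) (y : nat -> Jsd G -> dtraj G)
    (ush : nat -> Jsh G -> time G -> R) :=
  forall tau, (1 <= tau <= taubar)%N -> forall t,
    ZT_stationary t (ZT_arg y ush tau t) (ZT_rho rho tau) (x tau t).

Definition ZJ_all_optimal (taubar : nat) (rho : nat -> R)
    (x : nat -> time G -> xvar G -> R) (y : nat -> Jsd G -> dtraj G) :=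
  forall tau, (1 <= tau <= taubar)%N -> forall j,
    ZJ_optimal j (dev_part (x tau) j) (rho tau) (y tau j).

Definition diamT t : R := sup [set r : R | exists x x',
  [/\ ZT_feas t x, ZT_feas t x' & r = eucl_norm (fun c => x c - x' c)]].

(* RT only depends on the (p, q) coordinates of its argument, so that its
   supergradients vanish on the u^on and u^sh coordinates. *)
Definition lipschitzT t (L : R) :=
  (forall x x', ZT_feas t x -> ZT_feas t x' ->
     `|RT t x - RT t x'| <= L * eucl_norm (fun c => x c - x' c)) /\
  (forall x g, ZT_feas t x -> supergradient (RT t) x g -> eucl_norm g <= L).

Definition rangeJ j : R := sup [set r : R | exists y y',
  [/\ Xuc j y, Xuc j y' & r = RJ j y - RJ j y']].

Definition rangeR : R := \sum_j rangeJ j.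

End Model.

(* Main.v *)
(* The feasible set of Z^T_t is nonconvex only through the network variables,
   and u^sh enters X^ac only through p^sh = g u^sh v^2 and q^sh = -b u^sh v^2.
   Hence, from a stationary point w, one may move in a straight line towards the
   copy wbar while v, theta, tau, phi stay fixed: (S) and the nonnegativity of
   the power curves put X^uc inside Y^uc, and all constraints are affine along
   the segment.  The KKT conditions then bound the objective on the segment by
   its value at w; the penalty decreases at initial rate 2 rho ||w - wbar||_2^2
   and R^T_t changes at rate at most L_t D_t, so
   2 rho ||w - wbar||_2^2 <= L_t D_t.  Cauchy-Schwarz turns this into the first
   bound.  Comparing the optimum of Z^J_j with the previous copy, and using that
   rounding picks a nearest integer, the distance from w^(tau) to wbar^(tau) is
   at most R / rho plus its distance to wbar^(tau-1); the triangle inequality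
   gives the other two bounds.  The diameters and ranges are suprema, so they are
   meaningful only because the feasible sets and the functions R^J_j on X^uc_j
   are bounded. *)
Require Import Defs.
From mathcomp Require Import all_boot all_order all_algebra.
From mathcomp Require Import all_classical all_reals all_analysis.
From mathcomp Require Import ring lra.
Import Order.TTheory GRing.Theory Num.Theory.

Set Implicit Arguments.
Unset Strict Implicit.
Unset Printing Implicit Defensive.

Local Open Scope ring_scope.

(** * Functions affine in some coordinates with the others frozen, and KKT points along segments *)

Section AffineAlong.
Variables (R : realType) (V : finType) (S : pred V) (z : V -> R).
Implicit Types (f g : (V -> R) -> R) (y : V -> R).

Definition agree_off y := forall v, ~~ S v -> y v = z v.

(** The coefficients may depend on the base point [z], so the product of a moving coordinate with
    frozen ones counts as affine. *)
Definition affine_along f := exists a : V -> R,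
  forall y, agree_off y -> f y = f z + \sum_v a v * (y v - z v).

Lemma affine_inv f : (forall y, agree_off y -> f y = f z) -> affine_along f.
Proof.
move=> fz; exists (fun=> 0) => y /fz ->.
by rewrite big1 ?addr0// => v _; rewrite mul0r.
Qed.

Lemma affine_coord v : affine_along (fun y => y v).
Proof.
exists (fun u => (u == v)%:R) => y _.
rewrite (bigD1 v)//= eqxx mul1r big1 ?addr0 ?subrKC//.
by move=> u /negPf ->; rewrite mul0r.
Qed.

Lemma affineD f g :
  affine_along f -> affine_along g -> affine_along (fun y => f y + g y).
Proof.
move=> [a fE] [b gE]; exists (fun v => a v + b v) => y yz.
rewrite fE// gE// addrACA -big_split/=.
by congr (_ + _); apply: eq_bigr => v _; rewrite mulrDl.
Qed.

Lemma affineMl k f : (forall y, agree_off y -> k y = k z) ->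
  affine_along f -> affine_along (fun y => k y * f y).
Proof.
move=> kE [a fE]; exists (fun v => k z * a v) => y yz.
by rewrite fE// kE// mulrDr mulr_sumr; under [in RHS]eq_bigr do rewrite -mulrA.
Qed.

Lemma affineMr k f : (forall y, agree_off y -> k y = k z) ->
  affine_along f -> affine_along (fun y => f y * k y).
Proof.
by move=> kE /(affineMl kE) [a fE]; exists a => y yz; rewrite mulrC fE// mulrC.
Qed.

Lemma affineN f : affine_along f -> affine_along (fun y => - f y).
Proof.
move=> [a fE]; exists (fun v => - a v) => y yz.
by rewrite fE// opprD -sumrN; under eq_bigr do rewrite -mulNr.
Qed.

Lemma affineB f g :
  affine_along f -> affine_along g -> affine_along (fun y => f y - g y).
Proof. by move=> Hf Hg; apply: affineD => //; apply: affineN. Qed.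

Lemma affine_sum (I : Type) (s : seq I) (P : pred I) (F : I -> (V -> R) -> R) :
  (forall i, affine_along (F i)) ->
  affine_along (fun y => \sum_(i <- s | P i) F i y).
Proof.
move=> HF; elim: s => [|i s IH].
  by apply: affine_inv => y _; rewrite !big_nil.
have [a sE] := IH; have [b FE] := HF i.
case Pi : (P i); last first.
  by exists a => y yz; rewrite !big_cons Pi sE.
have [c E] := affineD (HF i) IH.
by exists c => y yz; rewrite !big_cons Pi E.
Qed.

(** Varying one coordinate of [S] preserves [agree_off], so the function being differentiated is a
    genuine affine function of one real variable. *)
Lemma partial_affine f (a : V -> R) v :
  (forall y, agree_off y -> f y = f z + \sum_u a u * (y u - z u)) -> S v ->
  partial f z v = a v.
Proof.
move=> fE Sv; rewrite /partial.
have -> : (fun s : R => f (fun c => if c == v then s else z c) : R^o) =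
    (fun s => (f z - a v * z v) + a v *: (s : R^o)).
  apply/funext => s; rewrite fE => [|u]; last first.
    by case: eqP => // ->; rewrite Sv.
  rewrite (bigD1 v)//= eqxx big1 => [|u /negPf ->]; last by rewrite subrr mulr0.
  by rewrite addr0 mulrBr addrCA addrC.
rewrite derive1E derive_val.
by rewrite add0r mul1r; exact: mulr1.
Qed.

Lemma sum_partial_affine f y : affine_along f -> agree_off y ->
  \sum_v partial f z v * (y v - z v) = f y - f z.
Proof.
move=> [a fE] yz; rewrite (fE y yz) addrAC subrr add0r.
(* Off [S] the increment [y v - z v] is zero, whatever the partial derivative is. *)
apply: eq_bigr => v _; have [Sv|/yz->] := boolP (S v).
  by rewrite (partial_affine fE Sv).
by rewrite subrr !mulr0.
Qed.

Definition segment (x y : V -> R) (s : R) : V -> R :=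
  fun v => x v + s * (y v - x v).

Lemma affine_segment f y s : affine_along f -> agree_off y ->
  f (segment z y s) = f z + s * (f y - f z).
Proof.
move=> [a fE] yz; rewrite (fE y yz) fE => [|v Sv]; last first.
  by rewrite /segment yz// subrr mulr0 addr0.
congr (_ + _); rewrite addrAC subrr add0r mulr_sumr.
by apply: eq_bigr => v _; rewrite /segment addrAC subrr add0r mulrCA.
Qed.

Definition affine_cstr (c : constr R V) : bool := `[< affine_along (resid c) >].

Lemma affine_cstrP c : reflect (affine_along (resid c)) (affine_cstr c).
Proof. exact: asboolP. Qed.

Lemma sat_segment cs y s : all affine_cstr cs -> agree_off y -> 0 <= s <= 1 ->
  sat cs z -> sat cs y -> sat cs (segment z y s).
Proof.
move=> acs yz /andP[s0 s1]; rewrite /sat.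
elim: cs acs => //= c cs IH /andP[/affine_cstrP ac acs] /andP[cz csz] /andP[cy csy].
rewrite IH// andbT; move: cz cy; rewrite /holds.
case: (is_eqn c) => [/eqP cz /eqP cy|cz cy]; rewrite affine_segment//.
  by rewrite cz cy subrr mulr0 addr0.
have -> : resid c z + s * (resid c y - resid c z) =
  (1 - s) * resid c z + s * resid c y by ring.
have h1 : (1 - s) * resid c z <= 0 by rewrite mulr_ge0_le0 ?subr_ge0.
have h2 : s * resid c y <= 0 by rewrite mulr_ge0_le0.
lra.
Qed.

(** Pairing the stationarity equation with [y - z] turns the first-order term into a sum of
    [lam k * (resid y - resid z)]. Equations contribute zero; by complementary slackness an
    inequality contributes [lam k * resid y <= 0]. The supergradient inequality then caps the
    objective along the whole ray. *)
Lemma KKT_segment obj cs y s : KKT obj cs z -> all affine_cstr cs ->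
  agree_off y -> sat cs y -> 0 <= s -> obj (segment z y s) <= obj z.
Proof.
move=> [csz [g [lam [gobj lamP gE]]]] acs yz csy s0.
apply: le_trans (gobj _) _; rewrite gerDl.
have -> : \sum_v g v * (segment z y s v - z v) =
    s * \sum_v g v * (y v - z v).
  rewrite mulr_sumr; apply: eq_bigr => v _.
  by rewrite /segment addrAC subrr add0r mulrCA.
rewrite mulr_ge0_le0//.
under eq_bigr do rewrite gE mulr_suml.
rewrite exchange_big/=; apply: sumr_le0 => k _.
under eq_bigr do rewrite -mulrA.
rewrite -mulr_sumr.
set c0 := Constr true (fun=> 0); set c := nth c0 cs k.
have /affine_cstrP ac : affine_cstr c by exact: (all_nthP c0 acs).
rewrite sum_partial_affine//.
have cz : holds c z by exact: (all_nthP c0 csz).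
have cy : holds c y by exact: (all_nthP c0 csy).
move: cz cy; rewrite /holds; have := lamP k (ltn_ord k); rewrite -/c.
case: (is_eqn c) => [_ /eqP -> /eqP ->|/(_ isT)[lam0 lamz] cz cy].
  by rewrite subrr mulr0.
by rewrite mulrBr lamz subr0 mulr_ge0_le0.
Qed.

End AffineAlong.
Arguments affine_cstr : simpl never.

Lemma all_flatten (T : Type) (P : pred T) (ss : seq (seq T)) :
  all P (flatten ss) = all (all P) ss.
Proof. by elim: ss => //= s ss <-; rewrite all_cat. Qed.

Lemma all_flatten_enum (T : Type) (J : finType) (P : pred T) (F : J -> seq T) :
  (forall j, all P (F j)) -> all P (flatten [seq F j | j <- enum J]).
Proof. by move=> PF; rewrite all_flatten all_map; apply/allP => j _ /=. Qed.

Lemma all_map_enum (T : Type) (J : finType) (P : pred T) (F : J -> T) :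
  (forall j, P (F j)) -> all P [seq F j | j <- enum J].
Proof. by move=> PF; rewrite all_map; apply/allP => j _ /=. Qed.

Lemma sat_flatten_enum (R : realType) (V : Type) (J : finType)
    (F : J -> seq (constr R V)) z :
  sat (flatten [seq F j | j <- enum J]) z -> forall j, sat (F j) z.
Proof.
by rewrite /sat all_flatten all_map => /allP h j; apply: h; rewrite mem_enum.
Qed.

(** * Calculus of functions bounded on a set *)

Section BoundedOn.
Variables (R : realType) (T : Type) (A : set T).
Implicit Types f g : T -> R.

Definition bounded_on f := exists M, forall x, A x -> `|f x| <= M.

Lemma bounded_cst k : bounded_on (fun=> k).
Proof. by exists `|k|. Qed.

Lemma boundedD f g :
  bounded_on f -> bounded_on g -> bounded_on (fun x => f x + g x).
Proof.
move=> [M fM] [N gN]; exists (M + N) => x Ax.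
by rewrite (le_trans (ler_normD _ _))// lerD ?fM ?gN.
Qed.

Lemma boundedN f : bounded_on f -> bounded_on (fun x => - f x).
Proof. by move=> [M fM]; exists M => x Ax; rewrite normrN fM. Qed.

Lemma boundedB f g :
  bounded_on f -> bounded_on g -> bounded_on (fun x => f x - g x).
Proof. by move=> bf bg; apply: boundedD => //; apply: boundedN. Qed.

Lemma boundedM f g :
  bounded_on f -> bounded_on g -> bounded_on (fun x => f x * g x).
Proof.
move=> [M fM] [N gN]; exists (M * N) => x Ax.
by rewrite normrM ler_pM ?fM ?gN.
Qed.

Lemma bounded_sum (I : Type) (s : seq I) (P : pred I) (F : I -> T -> R) :
  (forall i, bounded_on (F i)) -> bounded_on (fun x => \sum_(i <- s | P i) F i x).
Proof.
move=> HF; elim: s => [|i s [M sM]].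
  by exists 0 => x _; rewrite big_nil normr0.
have [N FN] := HF i; exists (N + M) => x Ax; rewrite big_cons.
case: (P i); first by rewrite (le_trans (ler_normD _ _))// lerD ?FN ?sM.
by rewrite (le_trans (sM _ Ax))// lerDr (le_trans _ (FN x Ax)).
Qed.

Lemma bounded_between lo hi f : bounded_on lo -> bounded_on hi ->
  (forall x, A x -> lo x <= f x <= hi x) -> bounded_on f.
Proof.
move=> [M loM] [N hiN] fE; exists (M + N) => x Ax.
have /andP[f1 f2] := fE x Ax; have := loM x Ax; have := hiN x Ax.
rewrite !ler_norml => /andP[? ?] /andP[? ?]; apply/andP; split; lra.
Qed.

Lemma bounded_itv (a b : R) f :
  (forall x, A x -> a <= f x <= b) -> bounded_on f.
Proof. exact: bounded_between (bounded_cst _) (bounded_cst _). Qed.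

Lemma bounded_pos_part f : bounded_on f -> bounded_on (fun x => pos_part (f x)).
Proof.
move=> [M fM]; exists M => x Ax; rewrite /pos_part; have := fM x Ax.
by case: (leP (f x) 0) => // _; rewrite normr0; apply: le_trans.
Qed.

Lemma eq_bounded f g : (forall x, A x -> f x = g x) -> bounded_on g -> bounded_on f.
Proof. by move=> fg [M gM]; exists M => x Ax; rewrite fg ?gM. Qed.

End BoundedOn.

Lemma has_ubound_bounded (R : realType) (T : Type) (A : set T) (f : T -> T -> R)
    (M : R) : (forall x y, A x -> A y -> f x y <= M) ->
  has_ubound [set r | exists x y, [/\ A x, A y & r = f x y]]%classic.
Proof. by move=> fM; exists M => _ [x [y [Ax Ay ->]]]; exact: fM. Qed.

(** The chord between [-N] and [N] bounds [f] from above; midpoint convexity,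
    [f 0 <= (f x + f (- x)) / 2], then bounds it from below. *)
Lemma convex_bounded (R : realType) (f : R -> R) (M : R) :
  Defs.convex f -> bounded_on [set x : R | `|x| <= M]%classic f.
Proof.
move=> fconv.
have conv_le s a b : 0 <= s <= 1 ->
    f (s * a + (1 - s) * b) <= s * f a + (1 - s) * f b.
  move=> /andP[s0 s1].
  have := fconv (Itv01 s0 s1) a b; rewrite !inE => /(_ I I).
  by rewrite !convRE.
(* Adding 1 makes the half-width positive for every [M], so that one can divide by [2 * N]. *)
have [N0 MN] : 0 < `|M| + 1 /\ M <= `|M| + 1.
  by split; have := normr_ge0 M; have := ler_norm M; lra.
set N := _ + 1 in N0 MN.
set U := Num.max (f N) (f (- N)).
have ub x : `|x| <= M -> f x <= U.
  rewrite ler_norml => /andP[xl xu].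
  set s := (x + N) / (2 * N).
  have s01 : 0 <= s <= 1.
    by rewrite divr_ge0 ?ler_pdivrMr/=; lra.
  have -> : x = s * N + (1 - s) * (- N) by rewrite /s; field; lra.
  rewrite (le_trans (conv_le _ _ _ s01))//.
  have h1 : s * f N <= s * U by rewrite ler_wpM2l ?le_max ?lexx//; lra.
  have h2 : (1 - s) * f (- N) <= (1 - s) * U.
    by rewrite ler_wpM2l ?le_max ?lexx ?orbT//; lra.
  lra.
have h2 : 0 <= (2^-1 : R) <= 1 by apply/andP; split; lra.
apply: (@bounded_itv _ _ _ (2 * f 0 - U) U) => x /= xM.
have := ub _ xM; have := ub (- x); rewrite normrN => /(_ xM).
have := conv_le _ x (- x) h2.
have -> : 2^-1 * x + (1 - 2^-1) * - x = 0 by lra.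
by move=> ? ? ?; apply/andP; split; lra.
Qed.

(** * The inclusion of X^uc in Y^uc, and boundedness of the period regions *)

Section Feasibility.
Variables (R : realType) (G : grid R).
Hypotheses (hG : grid_ok G) (hS : standing_assumption G).
Implicit Types (j : Jsd G) (t : time G).

Lemma binary_itv (u : R) : binary u -> 0 <= u <= 1.
Proof. by case=> ->; rewrite lexx ler01. Qed.

(** The trajectory's own startup and shutdown indicators are the auxiliary witnesses: (P2) makes the
    curve inequalities tight, and the standing assumption supplies (S). *)
Lemma Xuc_Yuc_cstr j t (y : dtraj G) : Xuc j y ->
  sat (Yuc_cstr j t) (lpoint (dval y t) (dsu y) (dsd y)).
Proof.
move=> [hU hP2 _ /(_ t)]; have hSy := U_implies_S hS hU t.
have [_ _ _ ubin] := hU; have [psuE psdE] := hP2 t.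
rewrite /Yuc_cstr /sat !all_cat => /and4P[-> -> -> ->] /=.
rewrite /holds /= !subr_le0 psuE psdE !lexx.
case: hSy => -> ->; have [/binary_itv/andP[-> _] _ _] := ubin t.
rewrite !sumr_ge0/=.
- apply: all_flatten_enum => t' /=; rewrite !subr_le0.
  have [_ /binary_itv/andP[-> ->] /binary_itv/andP[-> ->]] := ubin t'.
  by [].
- move=> t' _; rewrite mulr_ge0 ?(psdpc_ge0 hG)//.
  by have [_ _ /binary_itv/andP[-> _]] := ubin t'.
- move=> t' _; rewrite mulr_ge0 ?(psupc_ge0 hG)//.
  by have [_ /binary_itv/andP[-> _] _] := ubin t'.
Qed.

Lemma Yuc_cstrP j t (l : lvar G -> R) : sat (Yuc_cstr j t) l ->
  [/\ in_poly (Xp j t) (fun c => l (P3_coord c)),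
      sat (Q_cstr j t) l,
      0 <= l Psu <= \sum_(t' | Tsupc j t t') psupc j t t' * l (Lsu t'),
      0 <= l Psd <= \sum_(t' | Tsdpc j t t') psdpc j t t' * l (Lsd t')
    & forall t', 0 <= l (Lsu t') <= 1 /\ 0 <= l (Lsd t') <= 1].
Proof.
rewrite /sat /Yuc_cstr !all_cat /P3_cstr /pullback all_map.
move=> /and5P[_ hp _ hq /and3P[_ hs /sat_flatten_enum hu]].
split=> // [||t'].
- by move: hs; rewrite /= /holds /= !subr_le0 => /and5P[-> ->].
- by move: hs; rewrite /= /holds /= !subr_le0 => /and5P[_ _ -> ->].
- by have := hu t'; rewrite /= /holds /= !subr_le0 andbT => /and4P[-> -> -> ->].
Qed.

(** The argument runs on the lifted set, since (Q) and the power curves involve the auxiliary [Lsu]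
    and [Lsd]. *)
Lemma Yuc_bounded j t (v : dvar G) : bounded_on (Yuc j t) (fun z => z v).
Proof.
suff [M lM] : bounded_on [set l | sat (Yuc_cstr j t) l]%classic
    (fun l => l (Loc v)).
  by exists M => z [usu [usd /lM]].
set A := (X in bounded_on X).
have bXp c : bounded_on A (fun l => l (P3_coord c)).
  have [M zM] := Xp_bounded hS j t; exists M => l.
  by move=> /Yuc_cstrP[/zM].
have bu t' : bounded_on A (fun l => l (Lsu t')) /\
    bounded_on A (fun l => l (Lsd t')).
  by split; apply: (bounded_itv (a := 0) (b := 1)) => l /Yuc_cstrP[_ _ _ _];
    case/(_ t').
have bcst := @bounded_cst R _ A.
have bsum (P : pred (time G)) (k : time G -> R) (u : time G -> lvar G) :
    (forall t', bounded_on A (fun l => l (u t'))) ->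
    bounded_on A (fun l => \sum_(t' | P t') k t' * l (u t')).
  by move=> hu; apply: bounded_sum => t'; apply: boundedM.
have bsu P k := bsum P k Lsu (fun t' => (bu t').1).
have bsd P k := bsum P k Lsd (fun t' => (bu t').2).
have bsigma : bounded_on A (sigma j t).
  apply: boundedD; first (apply: boundedD; first exact: (bXp CUon)).
    by apply: bounded_sum => t'; case: (bu t').
  by apply: bounded_sum => t'; case: (bu t').
have bptot := bXp CPtot.
have qE l : A l ->
    [/\ l Qtot <= qmax j t * sigma j t l + betamax j * l Ptot
          - l (Qres (producing j)),
        qmin j t * sigma j t l + betamin j * l Ptot
          + l (Qres (~~ producing j)) <= l Qtot
      & forall b, 0 <= l (Qres b)].
  move=> /Yuc_cstrP[_ + _ _ _]; rewrite /= /holds /= !subr_le0 andbT => /and4P[-> -> r1 r0].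
  by split=> // -[].
have bhi : bounded_on A (fun l => qmax j t * sigma j t l + betamax j * l Ptot).
  by apply: boundedD; apply: boundedM.
have blo : bounded_on A (fun l => qmin j t * sigma j t l + betamin j * l Ptot).
  by apply: boundedD; apply: boundedM.
case: v => [||||r||b|].
- exact: (bXp CPtot).
- exact: (bXp CPon).
- apply: (bounded_between (bcst 0) (bsu (Tsupc j t) (psupc j t))) => l.
  by move=> /Yuc_cstrP[_ _ + _ _].
- apply: (bounded_between (bcst 0) (bsd (Tsdpc j t) (psdpc j t))) => l.
  by move=> /Yuc_cstrP[_ _ _ + _].
- exact: (bXp (CPres r)).
- apply: (bounded_between blo bhi) => l /qE[q1 q2 q0].
  have := q0 (producing j); have := q0 (~~ producing j).
  by move=> ? ?; apply/andP; split; lra.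
(* Combining the two inequalities of (Q) eliminates q^tot and bounds the sum of the two nonnegative
   reserves. *)
- apply: (bounded_between (bcst 0) (boundedB bhi blo)) => l /qE[q1 q2 q0].
  rewrite q0/=; have := q0 false; have := q0 true; move: q1 q2.
  by case: (producing j); case: b => /= ? ? ? ?; lra.
- exact: (bXp CUon).
Qed.

Ltac bounded_tac := do ?[assumption | exact: bounded_cst | apply: boundedD
  | apply: boundedB | apply: boundedM | apply: boundedN].

Lemma ZT_feas_bounded t (c : xvar G) : bounded_on (ZT_feas t) (fun x => x c).
Proof.
case: c => [[j v|h]|c].
- have [M zM] := Yuc_bounded j t v; exists M => x [_ /(_ j) /zM + _].
  exact.
- by apply: (bounded_itv (a := (ushmin h)%:~R) (b := (ushmax h)%:~R)) => x [_ _ /(_ h)].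
suff [M zM] : bounded_on [set z | sat (ac_cstr G) z /\
    forall h, (ushmin h)%:~R <= z (Ush h) <= (ushmax h)%:~R]%classic
    (fun z : zvar G -> R => z c).
  by exists M => x [[a xa] _ xu]; apply: (zM (zpoint x a)); split.
set A := (X in bounded_on X).
have bcst := @bounded_cst R _ A.
have F1 z : A z -> sat (F1_cstr G) z.
  by move=> [+ _]; rewrite /ac_cstr /sat !all_cat => /and3P[].
have F2 z : A z -> sat (F2_cstr G) z.
  by move=> [+ _]; rewrite /ac_cstr /sat !all_cat => /and3P[].
have F3 z : A z -> sat (F3_cstr G) z.
  by move=> [+ _]; rewrite /ac_cstr /sat !all_cat => /and3P[].
have bv i : bounded_on A (fun z => z (Vm i)).
  apply: (bounded_itv (a := vmin i) (b := vmax i)) => z /F3.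
  rewrite /F3_cstr /sat !all_cat => /and3P[/sat_flatten_enum /(_ i) + _ _].
  by rewrite /= /holds /= !subr_le0 andbT.
(* Taps stay above a positive [taumin], which keeps their inverses bounded. *)
have btap e : bounded_on A (fun z => (z (Tap e))^-1).
  apply: (bounded_itv (a := 0) (b := (taumin e)^-1)) => z /F3.
  rewrite /F3_cstr /sat !all_cat => /and3P[_ /sat_flatten_enum /(_ e) + _].
  rewrite /= /holds /= !subr_le0 andbT => /and4P[_ _ h _].
  have [t0 _] := tap_bounds_gt0 hG e.
  have z0 := lt_le_trans t0 h.
  by rewrite invr_ge0 (ltW z0)/= lef_pV2.
have btap2 e : bounded_on A (fun z => (z (Tap e) ^+ 2)^-1).
  apply: (eq_bounded (g := fun z : zvar G -> R => (z (Tap e))^-1 * (z (Tap e))^-1)).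
    by move=> z _; rewrite expr2 invfM.
  exact: boundedM.
(* (F3) puts no box on theta and Delta, but the flows see them only through sine and cosine. *)
have bcos e : bounded_on A (fun z => cos (z (Delta e))).
  by exists 1 => z _; exact: cos_max.
have bsin e : bounded_on A (fun z => sin (z (Delta e))).
  by exists 1 => z _; exact: sin_max.
have bush h : bounded_on A (fun z => z (Ush h)).
  by apply: (bounded_itv (a := (ushmin h)%:~R) (b := (ushmax h)%:~R)) => z [].
have bdc (e : Jdc G) : [/\ bounded_on A (fun z => z (Pfr (inr e))),
    bounded_on A (fun z => z (Pto (inr e))),
    bounded_on A (fun z => z (Qfr (inr e)))
  & bounded_on A (fun z => z (Qto (inr e)))].
  suff h z : A z ->
      [/\ - pdcmax e <= z (Pfr (inr e)) <= pdcmax e,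
          - pdcmax e <= z (Pto (inr e)) <= pdcmax e,
          qfrmin e <= z (Qfr (inr e)) <= qfrmax e
        & qtomin e <= z (Qto (inr e)) <= qtomax e].
    by split; apply: bounded_itv => z /h[? ? ? ?]; eassumption.
  move=> /F3; rewrite /F3_cstr /sat !all_cat.
  move=> /and3P[_ _ /sat_flatten_enum /(_ e)].
  rewrite /= /holds /= !subr_le0 andbT.
  by move=> /and4P[-> -> -> /and5P[-> -> -> -> ->]].
have bac (c' : zvar G) (f : (zvar G -> R) -> R) : bounded_on A f ->
    (forall z, A z -> z c' - f z == 0) -> bounded_on A (fun z => z c').
  by move=> bf h; apply: (eq_bounded _ bf) => z /h; rewrite subr_eq0 => /eqP.
have F1e (e : Jac G) z (Az : A z) := sat_flatten_enum (F1 z Az) e.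
have F2h (h : Jsh G) z (Az : A z) :
    z (Psh h) - g_sh h * z (Ush h) * z (Vm (sh_bus h)) ^+ 2 == 0 /\
    z (Qsh h) - - b_sh h * z (Ush h) * z (Vm (sh_bus h)) ^+ 2 == 0.
  have := F2 z Az; rewrite /F2_cstr /sat all_cat => /andP[_].
  by move=> /sat_flatten_enum /(_ h); rewrite /= /holds /= andbT => /andP.
case: c => [[e|e]|[e|e]|[e|e]|[e|e]|h|h]; try by case: (bdc e).
(* The bounded expression is read off the flow equation by solving the second goal first. *)
- eapply bac; last first.
    move=> z /(F1e e); rewrite /= /holds /= => /and5P[_ h _ _ _]; exact: h.
  by bounded_tac.
- eapply bac; last first.
    move=> z /(F1e e); rewrite /= /holds /= => /and5P[_ _ h _ _]; exact: h.
  by bounded_tac.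
- eapply bac; last first.
    move=> z /(F1e e); rewrite /= /holds /= => /and5P[_ _ _ h _]; exact: h.
  by bounded_tac.
- eapply bac; last first.
    move=> z /(F1e e); rewrite /= /holds /= => /and5P[_ _ _ _ h].
    move: h; rewrite andbT; exact: id.
  by bounded_tac.
- eapply bac; last by move=> z /(F2h h)[h1 _]; exact: h1.
  apply: boundedM; first by apply: boundedM.
  exact: boundedM.
- eapply bac; last by move=> z /(F2h h)[_ h1]; exact: h1.
  apply: boundedM; first by apply: boundedM.
  exact: boundedM.
Qed.

End Feasibility.

(** * The segment towards the previous copy, and affinity of the constraints along it *)

Section StationarityGap.
Variables (R : realType) (G : grid R).
Hypotheses (hG : grid_ok G) (hS : standing_assumption G).
Implicit Types (j : Jsd G) (t : time G) (z : zvar G -> R).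

Lemma zpoint_eta z : zpoint (fun c => z (Main c)) (fun a => z (Aux a)) = z.
Proof. by apply/funext; case. Qed.

Lemma sat_ZT_feas t z : sat (ZT_cstr t) z -> ZT_feas t (fun c => z (Main c)).
Proof.
rewrite /sat /ZT_cstr !all_cat => /and3P[hac /sat_flatten_enum hY hsh].
split=> [|j|h].
- by exists (fun a => z (Aux a)); rewrite zpoint_eta /sat /ac_cstr !all_cat.
- exists (fun s => z (Usu j s)), (fun s => z (Usd j s)).
  have := hY j; rewrite /sat /pullback all_map.
  by have -> : lpoint (fun v => z (Dev j v)) (fun s => z (Usu j s))
    (fun s => z (Usd j s)) = (fun v => z (dev_coord j v))
    by apply/funext; case.
- have := sat_flatten_enum hsh h.
  by rewrite /= /holds /= !subr_le0 andbT.
Qed.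

(** The shunt injections move together with u^sh to preserve (F2); branch flows, voltages, angles
    and taps are frozen. *)
Definition moved (c : zvar G) : bool :=
  match c with
  | Main (Blk _) | Main (Net (Psh _)) | Main (Net (Qsh _)) => true
  | Aux (Usu _ _) | Aux (Usd _ _) => true
  | _ => false
  end.

(* The voltages are kept, so that the shunt injections depend linearly on u^sh
   and the segment from z to this point stays in the nonconvex set X^ac. *)
Definition block_target (y : Jsd G -> dtraj G) (ush : Jsh G -> R) t z :
    zvar G -> R :=
  fun c => match c with
  | Main (Blk (Dev j v)) => dval (y j) t v
  | Main (Blk (Ush h)) => ush h
  | Main (Net (Psh h)) => g_sh h * ush h * z (Vm (sh_bus h)) ^+ 2
  | Main (Net (Qsh h)) => - b_sh h * ush h * z (Vm (sh_bus h)) ^+ 2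
  | Aux (Usu j s) => dsu (y j) s
  | Aux (Usd j s) => dsd (y j) s
  | _ => z c
  end.

Lemma block_target_agree y ush t z : agree_off moved z (block_target y ush t z).
Proof. by case=> [[[]|[]]|[]]. Qed.

(** (F1), (F3) and the DC equations contain only frozen coordinates; the shunt equations hold by
    construction, and the device constraints by the inclusion of X^uc in Y^uc. *)
Lemma block_target_sat (y : Jsd G -> dtraj G) ush t z :
  (forall j, Xuc j (y j)) -> (forall h, Ysh h (ush h)) ->
  sat (ZT_cstr t) z -> sat (ZT_cstr t) (block_target y ush t z).
Proof.
move=> hy hu; rewrite /sat /ZT_cstr !all_cat.
move=> /and3P[/and3P[F1 /andP[F2 _] /and3P[F31 F32 F33]] _ _].
rewrite -!andbA; apply/and5P; split; last (apply/and4P; split).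
- by apply: all_flatten_enum => e; exact: (sat_flatten_enum F1 e).
- by move: F2; rewrite !all_map.
- by apply: all_flatten_enum => h /=; rewrite /holds /= !subrr eqxx.
- by apply: all_flatten_enum => e; exact: (sat_flatten_enum F31 e).
- by apply: all_flatten_enum => e; exact: (sat_flatten_enum F32 e).
- by apply: all_flatten_enum => e; exact: (sat_flatten_enum F33 e).
- apply: all_flatten_enum => j; have := Xuc_Yuc_cstr hG hS t (hy j).
  rewrite /sat /pullback all_map.
  by have -> : lpoint (dval (y j) t) (dsu (y j)) (dsd (y j)) =
    (fun v => block_target y ush t z (dev_coord j v)) by apply/funext; case.
- apply: all_flatten_enum => h /=; have /andP[u1 u2] := hu h.
  by rewrite /holds /= !subr_le0 u1 u2.
Qed.

Ltac affine_tac := first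
  [ exact: affine_coord | exact: affine_inv
  | apply: affineD; affine_tac | apply: affineB; affine_tac
  | apply: affineN; affine_tac
  | apply: affine_sum => ?; affine_tac
  | apply: affineMl => //; affine_tac ].

(* Matched syntactically: apply/andP alone would unfold affine_cstr. *)
Ltac split_andb :=
  repeat match goal with |- is_true (_ && _) => apply/andP; split end.

Ltac affine_cstr_tac := rewrite /=; split_andb;
  first [done | apply/affine_cstrP; affine_tac].

Ltac inv_cstr_tac := rewrite /=; split_andb; first
  [done | apply/affine_cstrP; apply: affine_inv => ? /=;
          let h := fresh in intro h; by rewrite !h].

Lemma Yuc_affine j t z :
  all (affine_cstr moved z) (pullback (dev_coord j) (Yuc_cstr j t)).
Proof.
rewrite /pullback all_map.
rewrite /Yuc_cstr !all_cat; apply/and5P; split; last (apply/and3P; split).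
- by rewrite /P1_cstr; affine_cstr_tac.
- rewrite /P3_cstr /pullback /poly_cstr !all_map; apply/allP => r _ /=.
  by affine_cstr_tac.
- apply/andP; split; first by affine_cstr_tac.
  by apply: all_map_enum => r; affine_cstr_tac.
- by rewrite /Q_cstr /sigma; affine_cstr_tac.
- by rewrite /S_cstr; affine_cstr_tac.
- by affine_cstr_tac.
- by apply: all_flatten_enum => s; affine_cstr_tac.
Qed.

Lemma ZT_affine t z : all (affine_cstr moved z) (ZT_cstr t).
Proof.
rewrite /ZT_cstr /ac_cstr !all_cat.
apply/and3P; split; first (apply/and3P; split; [|apply/andP; split|apply/and3P; split]).
- by apply: all_flatten_enum => e; inv_cstr_tac.
- by apply: all_map_enum => e; inv_cstr_tac.
(* In the shunt equations the squared voltage is a frozen factor, which leaves them linear in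
   u^sh. *)
- apply: all_flatten_enum => h /=; rewrite andbT; apply/andP; split; apply/affine_cstrP.
    apply: affineB; first exact: affine_coord.
    apply: affineMr => [y yz|]; first by rewrite yz.
    by apply: affineMl => //; exact: affine_coord.
  apply: affineB; first exact: affine_coord.
  apply: affineMr => [y yz|]; first by rewrite yz.
  by apply: affineMl => //; exact: affine_coord.
- by apply: all_flatten_enum => i; inv_cstr_tac.
- by apply: all_flatten_enum => e; inv_cstr_tac.
- by apply: all_flatten_enum => e; inv_cstr_tac.
- by apply: all_flatten_enum => j; exact: Yuc_affine.
- by apply: all_flatten_enum => h; affine_cstr_tac.
Qed.

End StationarityGap.

(** * Euclidean norm and Cauchy-Schwarz *)

Section EuclNorm.
Variables (R : realType) (I : finType).
Implicit Types u : I -> R.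

Lemma eucl_norm_ge0 u : 0 <= eucl_norm u.
Proof. exact: sqrtr_ge0. Qed.

Lemma eucl_normZ (s : R) u : 0 <= s ->
  eucl_norm (fun i => s * u i) = s * eucl_norm u.
Proof.
move=> s0; rewrite /eucl_norm.
under eq_bigr do rewrite exprMn.
by rewrite -mulr_sumr sqrtrM ?sqr_ge0// sqrtr_sqr ger0_norm.
Qed.

(** Cauchy-Schwarz against the all-ones vector, by summing [u i * u j <= (u i ^+ 2 + u j ^+ 2) / 2]
    over all pairs. *)
Lemma sqr_sum_le (P : pred I) u :
  (\sum_(i | P i) u i) ^+ 2 <= #|P|%:R * \sum_(i | P i) u i ^+ 2.
Proof.
rewrite expr2 big_distrlr/=.
apply: (@le_trans _ _
  (\sum_(i | P i) \sum_(j | P j) (u i ^+ 2 + u j ^+ 2) / 2)).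
  apply: ler_sum => i _; apply: ler_sum => j _.
  by have := sqr_ge0 (u i - u j); nra.
rewrite (eq_bigr (fun i => (u i ^+ 2 *+ #|P| + \sum_(j | P j) u j ^+ 2) / 2)).
  2: by move=> i _; rewrite -mulr_suml big_split/= sumr_const.
rewrite -mulr_suml big_split/= sumr_const sumrMnl mulr_natl.
by set A := _ *+ _; lra.
Qed.

End EuclNorm.

(** * The penalty bound at a stationary point *)

Section Gap.
Variables (R : realType) (G : grid R).
Hypotheses (hG : grid_ok G) (hS : standing_assumption G).
Implicit Types (j : Jsd G) (t : time G).

Lemma diamT_ub t x x' : ZT_feas t x -> ZT_feas t x' ->
  eucl_norm (fun c => x c - x' c) <= diamT t.
Proof.
move=> xf xf'; apply: ub_le_sup; last by exists x, x'.
have /choice[M xM] := ZT_feas_bounded hG hS t.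
apply: (@has_ubound_bounded _ _ _ (fun x x' => eucl_norm (fun c => x c - x' c))
  (Num.sqrt (\sum_c (2 * M c) ^+ 2))) => {x x' xf xf'} x x' xf xf'.
apply/ler_wsqrtr/ler_sum => c _; rewrite -real_normK ?num_real//.
have := le_trans (ler_normB (x c) (x' c)) (lerD (xM c x xf) (xM c x' xf')).
have := normr_ge0 (x c - x' c).
nra.
Qed.

Lemma lipschitz_diamT t L x x' : lipschitzT t L ->
  ZT_feas t x -> ZT_feas t x' ->
  L * eucl_norm (fun c => x c - x' c) <= L * diamT t.
Proof.
move=> [lipL _] xf xf'; have [L0|L0] := leP 0 L.
  by rewrite ler_wpM2l// diamT_ub.
(* L < 0: the feasible region is a single point. *)
rewrite ler_nM2l//; apply: (@le_trans _ _ 0); last exact: eucl_norm_ge0.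
apply: ge_sup; first by exists (eucl_norm (fun c => x c - x' c)), x, x'.
move=> _ [y [y' [yf yf' ->]]]; have := le_trans (normr_ge0 _) (lipL _ _ yf yf').
by rewrite nmulr_rge0.
Qed.

Lemma ZT_stationary_gap t (y : Jsd G -> dtraj G) ush rho x L :
  (forall j, Xuc j (y j)) -> (forall h, Ysh h (ush h t)) -> 0 < rho ->
  lipschitzT t L -> ZT_stationary t (bar_block y ush t) rho x ->
  2 * rho * GammaT 2 (block x) (bar_block y ush t) <= L * diamT t.
Proof.
move=> hy hu rho0 hL [a kkt]; set b := bar_block y ush t in kkt *.
set z := zpoint x a in kkt; have sz := kkt.1.
set z' := block_target y (ush^~ t) t z.
have zz' : agree_off (@moved _ G) z z' by exact: block_target_agree.
have sz' : sat (ZT_cstr t) z' by exact: block_target_sat.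
have zaff := ZT_affine t z.
have xf : ZT_feas t x := sat_ZT_feas sz.
pose x' (c : xvar G) := z' (Main c).
have xf' : ZT_feas t x' := sat_ZT_feas sz'.
set Q := GammaT 2 (block x) b; set N := eucl_norm (fun c => x' c - x c).
apply: le_trans (lipschitz_diamT hL xf' xf); rewrite -/N.
have Q0 : 0 <= Q by apply: sumr_ge0 => c _; exact: exprn_ge0.
(* At parameter [s] the penalty has shrunk by the factor [(1 - s) ^+ 2], a gain of
   [s * rho * Q * (2 - s)]. The KKT conditions force R^T to lose at least as much, while it changes
   by at most [L * s * N]; dividing by [s] gives the claim. *)
have key s : 0 < s <= 1 -> rho * Q * (2 - s) <= L * N.
  move=> /andP[s0 s1].
  pose xs (c : xvar G) := segment z z' s (Main c).
  have xsf : ZT_feas t xs.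
    by apply: sat_ZT_feas; apply: (sat_segment zaff zz'); rewrite ?(ltW s0) ?s1.
  have := KKT_segment kkt zaff zz' sz' (ltW s0).
  rewrite /ZT_obj -/Q -/xs.
  have -> : GammaT 2 (block xs) b = (1 - s) ^+ 2 * Q.
    rewrite /Q /GammaT mulr_sumr; apply: eq_bigr => c _.
    rewrite !real_normK ?num_real// -exprMn; congr (_ ^+ 2).
    have -> : block xs c = x c + s * (b c - x c).
      by rewrite /block /xs /segment; case: c.
    by rewrite /block; ring.
  have := hL.1 xs x xsf xf.
  have -> : eucl_norm (fun c => xs c - x c) = s * N.
    rewrite -eucl_normZ ?(ltW s0)//; congr eucl_norm; apply/funext => c.
    by rewrite /xs /segment /x' /=; ring.
  rewrite (_ : (fun c => _) = x)// ler_norml => /andP[h1 h2] h3.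
  rewrite -(ler_pM2l s0); nra.
apply/ler_addgt0Pr => e e0.
(* This replaces the limit [s -> 0]: the missing term [s * rho * Q] is at most [e], and the 1 keeps
   the denominator positive. *)
set s := Num.min 1 (e / (rho * Q + 1)).
have rQ0 : 0 <= rho * Q by rewrite mulr_ge0// ltW.
have rQ1 : 0 < rho * Q + 1 by rewrite ltr_wpDl.
have s01 : 0 < s <= 1 by rewrite /s lt_min ge_min lexx ltr01 divr_gt0.
have se : s * (rho * Q + 1) <= e by rewrite -ler_pdivlMr// /s ge_min lexx orbT.
have := key s s01; have /andP[? ?] := s01; nra.
Qed.

End Gap.

(** * Device subproblems and shunt rounding *)

Section DeviceRange.
Variables (R : realType) (G : grid R).
Hypotheses (hG : grid_ok G) (hS : standing_assumption G).
Implicit Types (j : Jsd G) (t : time G).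

(** The binaries and p^tot are bounded on X^uc; the power terms are then bounded by convexity,
    applied to [- Rpow] for consumers. *)
Lemma RJ_bounded j : bounded_on (Xuc j) (RJ j).
Proof.
have bin t : [/\ bounded_on (Xuc j) (fun y => dval y t Uon),
    bounded_on (Xuc j) (fun y => dsu y t)
  & bounded_on (Xuc j) (fun y => dsd y t)].
  by split; apply: (bounded_itv (a := 0) (b := 1)) => y [[_ _ _ /(_ t)[? ? ?]] _ _ _];
    exact: binary_itv.
have bon t : bounded_on (Xuc j) (fun y => dval y t Uon) by case: (bin t).
have bsu t : bounded_on (Xuc j) (fun y => dsu y t) by case: (bin t).
have bsd t : bounded_on (Xuc j) (fun y => dsd y t) by case: (bin t).
have bptot t : bounded_on (Xuc j) (fun y => dval y t Ptot).
  have [M zM] := Yuc_bounded hS j t Ptot; exists M => y hy; apply: zM.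
  by exists (dsu y), (dsd y); exact: Xuc_Yuc_cstr.
have bcst := @bounded_cst R _ (Xuc j).
have ben (W : {set time G}) :
    bounded_on (Xuc j) (fun y => \sum_(t in W) dur t * dval y t Ptot).
  by apply: bounded_sum => t; apply: boundedM.
have bconv (f : R -> R) t : Defs.convex f ->
    bounded_on (Xuc j) (fun y => f (dval y t Ptot)).
  move=> fconv; have [M yM] := bptot t; have [K fK] := convex_bounded M fconv.
  by exists K => y /yM; exact: fK.
apply: boundedD; first apply: boundedB; first apply: boundedN.
- apply: bounded_sum => t; apply: boundedB.
    by apply: boundedD; first apply: boundedD; apply: boundedM.
  apply: bounded_sum => t'; apply: boundedM => //; apply: bounded_pos_part.
  by apply: boundedB => //; apply: boundedD.
- apply: boundedM => //; apply: boundedD; apply: bounded_sum => W;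
    apply: bounded_pos_part.
    exact: boundedB.
  exact: boundedD.
case: j bconv {bin bon bsu bsd bptot bcst ben} => i bconv.
  apply: boundedN; apply: bounded_sum => t.
  by apply: bconv; have [] := Cpow_ok hG i t.
apply: bounded_sum => t.
apply: (eq_bounded (g := fun y => - - Rpow i t (dval y t Ptot))) => [y _|].
  by rewrite opprK.
apply: boundedN; apply: (bconv (fun p => - Rpow i t p)).
by have [] := Rpow_ok hG i t.
Qed.

Lemma rangeJ_ub j y y' : Xuc j y -> Xuc j y' -> RJ j y - RJ j y' <= rangeJ j.
Proof.
move=> hy hy'; apply: ub_le_sup; last by exists y, y'.
have [M yM] := RJ_bounded j.
apply: (@has_ubound_bounded _ _ _ (fun y y' => RJ j y - RJ j y') (M + M)).
move=> {hy hy'} y {}y' /yM + /yM; rewrite !ler_norml => /andP[? ?] /andP[? ?].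
lra.
Qed.

(** Optimality against the competitor [y'] bounds [rho] times the penalty difference by a difference
    of rewards, hence by [rangeJ j]. *)
Lemma ZJ_optimal_gap j z rho y y' : 0 < rho -> ZJ_optimal j z rho y ->
  Xuc j y' -> GammaJ' 1 z (dval y) <= rangeJ j / rho + GammaJ' 1 z (dval y').
Proof.
move=> rho0 [hy yopt] hy'; rewrite -lerBlDr ler_pdivlMr//.
have := yopt y' hy'; rewrite /ZJ_obj; have := rangeJ_ub hy hy'; nra.
Qed.

(** The bounds are integers, so rounding a point between them cannot leave the interval. *)
Lemma ZSH_Ysh (h : Jsh G) u : (ushmin h)%:~R <= (ushmax h)%:~R :> R ->
  Ysh h (ZSH h u).
Proof.
move=> hh; rewrite /Ysh /ZSH /=.
set p := Num.max _ _; have p1 : (ushmin h)%:~R <= p by rewrite le_max lexx.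
have p2 : p <= (ushmax h)%:~R by rewrite ge_max hh ge_min lexx orbT.
apply/andP; split; rewrite ler_int.
  by rewrite floor_ge_int; lra.
by rewrite -ltzD1 floor_lt_int intrD; lra.
Qed.

(** On [Ysh] the projection is the identity and rounding moves [u] by at most 1/2; any other integer
    is at least 1 from the rounded value, hence at least 1/2 from [u]. *)
Lemma ZSH_nearest (h : Jsh G) (u : R) (n : int) : Ysh h u ->
  `|u - ZSH h u| <= `|u - n%:~R|.
Proof.
move=> /andP[u1 u2]; rewrite /ZSH (min_idPl u2) (max_idPr u1).
set f := Num.floor _; have /andP[f1 f2] := floor_itv (2^-1 + u).
rewrite -/f intrD in f1 f2.
have h1 : `|u - f%:~R| <= 2^-1 by rewrite ler_norml; apply/andP; split; lra.
have [->//|nf] := eqVneq n f.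
apply: le_trans h1 _; rewrite ler_normr; apply/orP.
have [nf'|nf'] := leP (n + 1) f.
  by left; move: nf'; rewrite -(ler_int R) intrD; lra.
right; move: nf'; rewrite ltzD1 le_eqVlt eq_sym (negPf nf)/= -lezD1 -(ler_int R) intrD.
lra.
Qed.

End DeviceRange.

(** * Splitting and metric properties of the penalties *)

Section GammaSums.
Variables (R : realType) (G : grid R).
Implicit Types (a b c : time G -> bvar G -> R).

Lemma sum_copied (F : bvar G -> R) :
  \sum_(c | copied c) F c =
  \sum_(j : Jsd G) \sum_(v | copied_dev v) F (Dev j v) + \sum_h F (Ush h).
Proof.
rewrite (reindex (@bvar_decode R G)) /=; last first.
  by exists (@bvar_code R G) => [[[]|]|[]].
rewrite big_sumType/=; congr (_ + _).
by rewrite pair_big_dep/=; apply: eq_big => -[].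
Qed.

(** The splitting mirrors the decoupled updates: one term per device problem and one per rounded
    shunt value. *)
Lemma Gamma_bar_block (x : time G -> xvar G -> R) (y : Jsd G -> dtraj G) ush :
  Gamma 1 (fun t => block (x t)) (bar_block y ush) =
  \sum_j GammaJ' 1 (dev_part x j) (dval (y j)) +
  \sum_t \sum_h `|x t (Ush h) - ush h t|.
Proof.
rewrite /Gamma /GammaT /GammaJ'.
under eq_bigr do rewrite sum_copied.
rewrite big_split/= exchange_big/=; congr (_ + _).
Qed.

Lemma Gamma_ge0 l a b : 0 <= Gamma l a b.
Proof. by do 2![apply: sumr_ge0 => ? _]; exact: exprn_ge0. Qed.

Lemma Gamma1C a b : Gamma 1 a b = Gamma 1 b a.
Proof.
by apply: eq_bigr => t _; apply: eq_bigr => c _; rewrite !expr1 distrC.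
Qed.

Lemma Gamma1_triangle b a c : Gamma 1 a c <= Gamma 1 a b + Gamma 1 b c.
Proof.
rewrite /Gamma -big_split/=; apply: ler_sum => t _.
rewrite /GammaT -big_split/=; apply: ler_sum => v _.
by rewrite !expr1 ler_distD.
Qed.

(** Cauchy-Schwarz is applied over periods, then over the copied entries of each; the two
    cardinalities multiply to [dim_w]. *)
Lemma Gamma1_sqr_le a b :
  Gamma 1 a b ^+ 2 <= (dim_w G)%:R * \sum_t GammaT 2 (a t) (b t).
Proof.
apply: le_trans (sqr_sum_le _ _) _.
rewrite card_ord /dim_w natrM -mulrA ler_wpM2l// mulr_sumr.
apply: ler_sum => t _; apply: le_trans (sqr_sum_le _ _) _.
by under eq_bigr do rewrite expr1.
Qed.

End GammaSums.

Theorem theorem1 (R : realType) (G : grid R)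
    (hG : grid_ok G) (hS : standing_assumption G)
    (taubar : nat) (rho : nat -> R)
    (hrho : forall tau, (1 <= tau <= taubar)%N -> 0 < rho tau)
    (x : nat -> time G -> xvar G -> R)
    (y : nat -> Jsd G -> dtraj G)
    (ush : nat -> Jsh G -> time G -> R)
    (hit : padm_iterates taubar x y ush)
    (hstat : ZT_all_stationary taubar rho x y ush)
    (L : time G -> R) (hL : forall t, lipschitzT t (L t)) :
  let C := \sum_t (dim_w G)%:R * L t * diamT t in
  let w tau := fun t => block (x tau t) in
  let wbar tau := bar_block (y tau) (ush tau) in
  (forall tau, (2 <= tau <= taubar)%N ->
     Gamma 1 (w tau) (wbar tau.-1) <= Num.sqrt (C / (2 * rho tau))) /\
  (ZJ_all_optimal taubar rho x y ->
     (forall tau, (2 <= tau <= taubar)%N ->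
        Gamma 1 (wbar tau) (wbar tau.-1)
          <= rangeR G / rho tau + Num.sqrt (2 * C / rho tau)) /\
     (forall tau, (2 <= tau <= taubar.-1)%N ->
        Gamma 1 (w tau.+1) (w tau)
          <= rangeR G / rho tau
             + Num.sqrt (2 * C / Num.min (rho tau) (rho tau.+1)))).
Proof.
move=> C w wbar.
have CE : C = (dim_w G)%:R * \sum_t L t * diamT t.
  by rewrite mulr_sumr; apply: eq_bigr => t _; rewrite mulrA.
(* Feasibility of the iterate shows that the shunt interval is nonempty, as rounding into it
   requires. *)
have hu tau h t : (1 <= tau <= taubar)%N -> Ysh h (ush tau h t).
  move=> /hit[/(_ t)[_ _ /(_ h)/andP[u1 u2]] _ ->]; apply: ZSH_Ysh.
  exact: le_trans u1 u2.
(* From the second iteration on, the previous copy is a genuine iterate and [ZT_arg], [ZT_rho] take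
   their penalized branch. *)
have gt1 tau : (2 <= tau <= taubar)%N ->
    [/\ (1 <= tau <= taubar)%N, (1 <= tau.-1 <= taubar)%N & (tau == 1)%N = false].
  by case: tau => [|[|tau]]//= h; split=> //; exact: ltnW.
have gap tau t : (2 <= tau <= taubar)%N ->
    2 * rho tau * GammaT 2 (w tau t) (wbar tau.-1 t) <= L t * diamT t.
  move=> /gt1[h1 h2 h3]; have [_ hX _] := hit _ h2.
  apply: (ZT_stationary_gap hG hS hX) => //.
  - by move=> h; exact: hu.
  - exact: hrho.
  - by have := hstat _ h1 t; rewrite /ZT_arg /ZT_rho h3.
have step1 tau : (2 <= tau <= taubar)%N ->
    Gamma 1 (w tau) (wbar tau.-1) <= Num.sqrt (C / (2 * rho tau)).
  move=> htau; have [h1 _ _] := gt1 _ htau; have rho0 := hrho _ h1.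
  rewrite -[leLHS]ger0_norm ?Gamma_ge0// -sqrtr_sqr; apply: ler_wsqrtr.
  apply: le_trans (Gamma1_sqr_le _ _) _.
  rewrite ler_pdivlMr ?mulr_gt0// -[leLHS]mulrA [X in _ * X]mulrC CE.
  rewrite ler_wpM2l// mulr_sumr; apply: ler_sum => t _.
  exact: gap.
split=> // hopt.
(* The previous copy competes in each Z^J_j, and the previous shunt value is an integer, no closer
   than the rounded one. *)
have step2 tau : (2 <= tau <= taubar)%N ->
    Gamma 1 (w tau) (wbar tau) <=
      rangeR G / rho tau + Gamma 1 (w tau) (wbar tau.-1).
  move=> htau; have [h1 h2 _] := gt1 _ htau; have rho0 := hrho _ h1.
  have [hZ _ ushE] := hit _ h1; have [_ hX ushE'] := hit _ h2.
  rewrite !Gamma_bar_block addrA lerD//.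
    rewrite /rangeR mulr_suml -big_split/=; apply: ler_sum => j _.
    exact: (ZJ_optimal_gap hG hS rho0 (hopt _ h1 j)).
  apply: ler_sum => t _; apply: ler_sum => h _.
  rewrite ushE ushE'; apply: ZSH_nearest.
  by have [_ _] := hZ t.
(* The sign of [L t] is not given; the gap at iteration 2 shows each summand to be nonnegative.
   Monotonicity in the penalty parameter below relies on this. *)
have C0 : (2 <= taubar)%N -> 0 <= C.
  move=> t2; apply: sumr_ge0 => t _; rewrite -mulrA mulr_ge0//.
  apply: le_trans (gap 2%N t _) => //.
  rewrite mulr_ge0 ?mulr_ge0//; last by apply: sumr_ge0 => c _; exact: exprn_ge0.
  by rewrite ltW// hrho//=.
have sqrt2 r : 0 < r ->
    Num.sqrt (2 * C / r) = 2 * Num.sqrt (C / (2 * r)).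
  move=> r0; have -> : 2 * C / r = 2 ^+ 2 * (C / (2 * r)).
    by field; rewrite gt_eqF.
  by rewrite sqrtrM ?sqr_ge0// sqrtr_sqr ger0_norm.
split=> tau htau.
  have [h1 _ _] := gt1 _ htau; rewrite sqrt2 ?hrho//.
  have := step1 _ htau; have := step2 _ htau.
  (* The path through [w tau] uses the first bound twice, and twice [Num.sqrt (C / (2 * r))] is
     [Num.sqrt (2 * C / r)]. *)
  have := Gamma1_triangle (w tau) (wbar tau) (wbar tau.-1).
  rewrite (Gamma1C (wbar tau) (w tau)); lra.
have [htau0 htau1] : (2 <= tau <= taubar)%N /\ (2 <= tau.+1 <= taubar)%N.
  (* For [taubar = 0] the truncated predecessor is 0, which [2 <= tau] excludes. *)
  case/andP: htau => t2 tT; have tT' : (tau < taubar)%N.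
    by case: (taubar) tT => // tT; exact: leq_trans t2 tT.
  by rewrite t2 ltnW// ltnS (ltnW t2).
have [h1 _ _] := gt1 _ htau0; have [h2 _ _] := gt1 _ htau1.
set m := Num.min _ _.
have m0 : 0 < m by rewrite lt_min !hrho.
have le_m r : m <= r -> Num.sqrt (C / (2 * r)) <= Num.sqrt (C / (2 * m)).
  move=> mr; apply/ler_wsqrtr/ler_wpM2l.
    by apply: C0; case/andP: htau0; exact: leq_trans.
  by rewrite lef_pV2 ?posrE ?mulr_gt0 ?(lt_le_trans m0 mr)// ler_pM2l.
rewrite sqrt2//.
have := step1 _ htau0; have := step2 _ htau0; have := step1 _ htau1.
(* The path now runs through [wbar tau], the copy previous to [w tau.+1]; the two square roots, at
   [rho tau.+1] and [rho tau], are both dominated by the one at the minimum. *)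
have := Gamma1_triangle (wbar tau) (w tau.+1) (w tau).
have := le_m (rho tau); have := le_m (rho tau.+1).
rewrite !ge_min !lexx orbT (Gamma1C (wbar tau) (w tau))/= => /(_ isT) + /(_ isT).
lra.
Qed.
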